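(* Let $f(z)=\sum_{n=0}^\infty a_{2n+1}z^{2n+1}$ and $g(z)=\sum_{n=0}^\infty b_{2n+1}z^{2n+1}$ be two odd analytic functions defined in $\mathbb{D}$, and let $\tilde{r}_0:=\sqrt{(4-\sqrt{13})/3}$. Then for all $r=|z|\leq \tilde{r}_0$: (i) if $g\prec f$, then $\mathcal{M}_{g'}(r)\leq \mathcal{M}_{f'}(r)$; (ii) if $|g(z)|\leq|f(z)|$ for all $z\in\mathbb{D}$, then $\mathcal{M}_{g'}(r)\leq \mathcal{M}_{f'}(r)$. This radius $\tilde{r}_0$ cannot be improved in either case: for each of (i) and (ii) and for every $r\in(\tilde{r}_0,1)$ there are odd analytic functions $f,g$ in $\mathbb{D}$ satisfying the hypothesis of that part with $\mathcal{M}_{g'}(r)>\mathcal{M}_{f'}(r)$.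
   Context: $\mathbb{D}$ denotes the open unit disk in $\mathbb{C}$. For a complex valued analytic function $F(z)=\sum_{n=0}^\infty A_nz^n$ in $\mathbb{D}$, its majorant series is $\mathcal{M}_F(r):=\sum_{n=0}^\infty |A_n|r^n$ for $0\le r<1$. For analytic functions $f,g$ in $\mathbb{D}$, $g\prec f$ ($g$ is subordinate to $f$) means that there is a function $\phi$ analytic in $\mathbb{D}$ with $\phi(0)=0$ and $|\phi(z)|<1$ for $z\in\mathbb{D}$ such that $g=f\circ\phi$. *)

(* Defs.v *)
(* Stdlib reals with Coquelicot's complex numbers. *)
From Stdlib Require Import Reals ClassicalEpsilon.
From Coquelicot Require Import Coquelicot.

Open Scope R_scope.

Definition in_disk (z : C) : Prop := Cmod z < 1.

Definition analytic_in_disk (F : C -> C) : Prop :=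
  forall z0 : C, in_disk z0 ->
    exists (rho : R) (A : nat -> C), 0 < rho /\
      forall z : C, Cmod (z - z0) < rho ->
        is_pseries (K := C_AbsRing) (V := C_NormedModule) A (z - z0)%C (F z).

Definition expansion_in_disk (F : C -> C) (A : nat -> C) : Prop :=
  forall z : C, in_disk z ->
    is_pseries (K := C_AbsRing) (V := C_NormedModule) A z (F z).

(* Every analytic F has exactly one expansion [A]; the value of [coeffs F] is
   meaningful only when F has one. *)
Definition coeffs (F : C -> C) : nat -> C :=
  epsilon (inhabits (fun _ : nat => RtoC 0)) (expansion_in_disk F).

Definition majorant_series (F : C -> C) (r : R) : R :=
  Series (fun n : nat => Cmod (coeffs F n) * r ^ n).

(* Only the odd-indexed entries of [a] matter. *)
Definition odd_analytic (f : C -> C) (a : nat -> C) : Prop :=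
  analytic_in_disk f /\
  forall z : C, in_disk z ->
    is_series (K := C_AbsRing) (V := C_NormedModule)
      (fun n : nat => (a (2 * n + 1)%nat * Cpow z (2 * n + 1))%C) (f z).

Definition subordinate (g f : C -> C) : Prop :=
  exists phi : C -> C,
    analytic_in_disk phi /\
    phi (RtoC 0) = RtoC 0 /\
    (forall z : C, in_disk z -> Cmod (phi z) < 1) /\
    (forall z : C, in_disk z -> g z = f (phi z)).

Definition dominated_in_disk (g f : C -> C) : Prop :=
  forall z : C, in_disk z -> Cmod (g z) <= Cmod (f z).

Definition r0_tilde : R := sqrt ((4 - sqrt 13) / 3).

(* Main.v *)
Require Import Defs.
From Stdlib Require Import Reals.
From Coquelicot Require Import Coquelicot.
From Stdlib Require Import Lra Lia Psatz Wf_nat ClassicalEpsilon Classical.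
Open Scope R_scope.

(** Both comparisons have one proof.  Write [f = sum_j a_(2j+1) z^(2j+1)].  If [g = f o phi],
    then [g = sum_j a_(2j+1) z^(2j+1) H_j] with [H_j = (phi / z)^(2j+1)]; if [|g| <= |f|],
    the same holds with every [H_j] equal to [h = g / f].  In both cases [|H_j| <= |z|^-(2j+1)],
    a bound that tends to one at the unit circle, so that the coefficients of [H_j] satisfy
    [|h_m| <= 2 (1 - tau_j)] for [m >= 1], with [tau_j = |h_0| <= 1]
    ([bounded_coefficients]).  As only even [m] contribute to odd coefficients of [g],
    [|b_(2J+1)| <= |a_(2J+1)| tau_J + sum_(j < J) 2 (1 - tau_j) |a_(2j+1)|]
    ([coefficient_comparison]).  Multiplying by [(2J+1) x^J] with [x = r^2] and summing, the
    term [j] of [f] contributes to the majorant of [g'] at most [|a_(2j+1)|] times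
    [(2j+1) x^j tau_j + 2 (1 - tau_j) sum_(J > j) (2J+1) x^J], and this is at most
    [(2j+1) x^j] as soon as [2 sum_(J > j) (2J+1) x^J <= (2j+1) x^j].  The case [j = 0] is
    the worst one and reads [3 x^2 - 8 x + 1 >= 0], that is [x <= (4 - sqrt 13) / 3]
    ([weighted_odd_sums_le]).

    Coefficients of [H_j] are read off from means over circles centred at the origin, which
    do not depend on the radius as long as the function is holomorphic in the punctured disc
    ([circle_mean_const]).  This is the only form of Cauchy's theorem that is used: a
    function that is [O(z)] at the origin has mean zero ([circle_mean_bigO]), and the
    estimate of the coefficients follows from integrating a nonnegative function
    ([weighted_mean_le]) and letting the radius tend to one.  In the second case the zeros of
    [f] are removable singularities of [g / f], by the local power series of [f] and [g]
    ([local_quotient]); the identity theorem excludes that [f] vanishes near a point without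
    vanishing identically ([identity_at_origin]).

    For the sharpness of the radius take [f = z] and [g = z (t - z^2) / (1 - t z^2)], with
    [t] close to one.  Then [|g| <= |f|], and [g] is also subordinate to [f]; all the
    inequalities above are asymptotically equalities as [t] tends to one
    ([majorant_blaschke_gt]). *)

(** * Complex derivatives *)

(** The plane carries two uniform structures, that of the modulus and that of a product
    of two lines.  Derivatives over the field [C] refer to the first one. *)
Notation Cmod_top := (AbsRing_UniformSpace C_AbsRing).
Notation is_Cderive := (is_derive (K := C_AbsRing) (V := AbsRing_NormedModule C_AbsRing)).
Notation Ccontinuous := (continuous (T := Cmod_top) (U := Cmod_top)).

Lemma locally_Cmod (z : C) (P : C -> Prop) :
  locally (T := Cmod_top) z P <->
  exists d : R, 0 < d /\ forall w : C, Cmod (w - z)%C < d -> P w.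
Proof.
  split.
  - intros [d Hd]. exists d. split; [apply cond_pos | exact Hd].
  - intros [d [Hd H]]. exists (mkposreal d Hd). exact H.
Qed.

Lemma center_in_ball (z : C) (d : R) : 0 < d -> Cmod (z - z)%C < d.
Proof.
  intros Hd. replace (z - z)%C with (RtoC 0) by ring. rewrite Cmod_0. exact Hd.
Qed.

Lemma Cmod_lt_exists (z0 : C) (d : R) : 0 < d -> exists z : C, 0 < Cmod (z - z0)%C < d.
Proof.
  intros Hd. exists (z0 + RtoC (d / 2))%C.
  replace (z0 + RtoC (d / 2) - z0)%C with (RtoC (d / 2)) by ring.
  rewrite Cmod_R, Rabs_pos_eq; lra.
Qed.

Lemma in_disk_near (z0 z : C) : Cmod (z - z0)%C < 1 - Cmod z0 -> in_disk z.
Proof.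
  intros Hz. unfold in_disk. replace z with ((z - z0) + z0)%C by ring.
  eapply Rle_lt_trans; [apply Cmod_triangle|]. lra.
Qed.

Lemma is_Cderive_eps (F : C -> C) (z l : C) :
  is_Cderive F z l <->
  forall eps : R, 0 < eps -> exists d : R, 0 < d /\ forall w : C,
    Cmod (w - z)%C < d ->
    Cmod (F w - F z - l * (w - z))%C <= eps * Cmod (w - z)%C.
Proof.
  split.
  - intros [_ H] eps Heps.
    specialize (H z (fun P HP => HP) (mkposreal eps Heps)).
    apply locally_Cmod in H. destruct H as [d [Hd H]].
    exists d. split; [exact Hd|]. intros w Hw. specialize (H w Hw).
    unfold norm in H; simpl in H.
    replace (l * (w - z))%C with ((w - z) * l)%C by ring. exact H.
  - intros H. split; [apply is_linear_scal_l|].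
    intros y Hy. 
    assert (Ey : y = z).
    { symmetry. apply (is_filter_lim_locally_unique (V := AbsRing_NormedModule C_AbsRing)). exact Hy. }
    subst y. intros eps.
    destruct (H eps (cond_pos eps)) as [d [Hd Hw]].
    apply locally_Cmod. exists d. split; [exact Hd|].
    intros w Hwz. specialize (Hw w Hwz).
    replace (l * (w - z))%C with ((w - z) * l)%C in Hw by ring. exact Hw.
Qed.

Lemma Ccontinuous_eps (F : C -> C) (z : C) :
  Ccontinuous F z <->
  forall eps : R, 0 < eps -> exists d : R, 0 < d /\ forall w : C,
    Cmod (w - z)%C < d -> Cmod (F w - F z)%C < eps.
Proof.
  split.
  - intros H eps Heps.
    destruct (proj1 (filterlim_locally _ _) H (mkposreal eps Heps)) as [d Hd].
    exists d. split; [apply cond_pos | exact Hd].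
  - intros H. apply filterlim_locally. intros eps.
    destruct (H eps (cond_pos eps)) as [d [Hd Hw]].
    exists (mkposreal d Hd). exact Hw.
Qed.

Lemma C_derive_unique (F : C -> C) (z l : C) :
  is_Cderive F z l -> C_derive F z = l.
Proof.
  intros [_ H]. apply is_C_derive_unique. split; [apply is_linear_scal_l | exact H].
Qed.

Lemma is_Cderive_mult (F G : C -> C) (z f g : C) :
  is_Cderive F z f -> is_Cderive G z g ->
  is_Cderive (fun w => F w * G w)%C z (f * G z + F z * g)%C.
Proof.
  intros HF HG.
  assert (H := filterdiff_mult_fct (K := C_AbsRing)
    (U := AbsRing_NormedModule C_AbsRing) F G z _ _ Cmult_comm HF HG).
  eapply filterdiff_ext_lin; [exact H|].
  intros y. unfold plus, mult, scal; simpl. unfold mult; simpl. ring.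
Qed.

Lemma is_Cderive_Ccontinuous (F : C -> C) (z l : C) :
  is_Cderive F z l -> Ccontinuous F z.
Proof.
  intros H. apply (ex_derive_continuous (K := C_AbsRing) (V := AbsRing_NormedModule C_AbsRing)).
  exists l. exact H.
Qed.

Lemma Ccontinuous_inv (F : C -> C) (z : C) :
  Ccontinuous F z -> F z <> 0 -> Ccontinuous (fun w => / F w)%C z.
Proof.
  intros HF Hz. apply Ccontinuous_eps. intros eps Heps.
  assert (Hm : 0 < Cmod (F z)) by (apply Cmod_gt_0; exact Hz).
  set (m := Cmod (F z)) in *.
  assert (He : 0 < Rmin (m / 2) (eps * (m * m) / 4)).
  { apply Rmin_pos; [lra|]. apply Rdiv_lt_0_compat; [|lra].
    apply Rmult_lt_0_compat; [exact Heps | nra]. }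
  destruct (proj1 (Ccontinuous_eps F z) HF _ He) as [d [Hd H]].
  exists d. split; [exact Hd|]. intros w Hw. specialize (H w Hw).
  assert (H1 := Rlt_le_trans _ _ _ H (Rmin_l _ _)).
  assert (H2 := Rlt_le_trans _ _ _ H (Rmin_r _ _)).
  assert (Hw2 : m / 2 <= Cmod (F w)).
  { assert (m <= Cmod (F w) + Cmod (F w - F z)%C).
    { unfold m. replace (F z) with (F w + - (F w - F z))%C at 1 by ring.
      eapply Rle_trans; [apply Cmod_triangle|]. rewrite Cmod_opp. lra. }
    lra. }
  assert (Fw : F w <> 0) by (apply Cmod_gt_0; lra).
  replace (/ F w - / F z)%C with (- (F w - F z) * / (F w * F z))%C
    by (field; split; assumption).
  rewrite Cmod_mult, Cmod_opp, Cmod_inv, Cmod_mult by (apply Cmult_neq_0; assumption).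
  fold m.
  apply Rmult_lt_reg_r with (Cmod (F w) * m); [nra|].
  rewrite Rmult_assoc, Rinv_l by nra.
  assert (Hmm : m * m / 4 < Cmod (F w) * m) by nra.
  assert (eps * (m * m / 4) < eps * (Cmod (F w) * m))
    by (apply Rmult_lt_compat_l; lra).
  lra.
Qed.

Lemma is_Cderive_inv (F : C -> C) (z l : C) :
  is_Cderive F z l -> F z <> 0 ->
  is_Cderive (fun w => / F w)%C z (- l / (F z * F z))%C.
Proof.
  intros HF Hz. assert (HFi := Ccontinuous_inv F z (is_Cderive_Ccontinuous _ _ _ HF) Hz).
  apply is_Cderive_eps. intros eps Heps.
  assert (Hm : 0 < Cmod (F z)) by (apply Cmod_gt_0; exact Hz).
  set (m := Cmod (F z)) in *. set (L := Cmod l).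
  assert (HL : 0 <= L) by apply Cmod_ge_0.
  assert (Him : 0 < / m) by (apply Rinv_0_lt_compat; exact Hm).
  assert (HmL : 0 < m / (2 * (1 + L))) by (apply Rdiv_lt_0_compat; lra).
  assert (He1 : 0 < Rmin (/ m) (eps * (m / (2 * (1 + L))))).
  { apply Rmin_pos; [exact Him | apply Rmult_lt_0_compat; assumption]. }
  assert (He2 : 0 < eps * (m * m) / 4) by (apply Rdiv_lt_0_compat; [repeat apply Rmult_lt_0_compat; assumption|lra]).
  destruct (proj1 (Ccontinuous_eps _ z) HFi _ He1) as [d1 [Hd1 H1]].
  destruct (proj1 (is_Cderive_eps _ _ _) HF _ He2) as [d2 [Hd2 H2]].
  destruct (proj1 (Ccontinuous_eps F z) (is_Cderive_Ccontinuous _ _ _ HF) m Hm) as [d3 [Hd3 H3]].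
  exists (Rmin d1 (Rmin d2 d3)). split; [repeat apply Rmin_pos; assumption|].
  intros w Hw.
  assert (Hw1 := Rlt_le_trans _ _ _ Hw (Rmin_l _ _)).
  assert (Hw' := Rlt_le_trans _ _ _ Hw (Rmin_r _ _)).
  assert (Hw2 := Rlt_le_trans _ _ _ Hw' (Rmin_l _ _)).
  assert (Hw3 := Rlt_le_trans _ _ _ Hw' (Rmin_r _ _)).
  specialize (H1 w Hw1). specialize (H2 w Hw2). specialize (H3 w Hw3).
  assert (Fw : F w <> 0).
  { intros E. rewrite E in H3. replace (0 - F z)%C with (- F z)%C in H3 by ring.
    rewrite Cmod_opp in H3. fold m in H3. lra. }
  assert (H1a := Rlt_le_trans _ _ _ H1 (Rmin_l _ _)).
  assert (H1b := Rlt_le_trans _ _ _ H1 (Rmin_r _ _)).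
  assert (Hi : Cmod (/ F w)%C <= 2 * / m).
  { replace (/ F w)%C with ((/ F w - / F z) + / F z)%C by ring.
    eapply Rle_trans; [apply Cmod_triangle|]. rewrite (Cmod_inv (F z)) by exact Hz.
    fold m. lra. }
  replace (/ F w - / F z - - l / (F z * F z) * (w - z))%C with
    (- (F w - F z - l * (w - z)) * (/ F w * / F z)
     + - (l * / F z * (w - z)) * (/ F w - / F z))%C by (field; split; assumption).
  eapply Rle_trans; [apply Cmod_triangle|].
  rewrite !Cmod_mult, !Cmod_opp, !Cmod_mult, (Cmod_inv (F z)) by exact Hz.
  fold m L. set (e := Cmod (w - z)%C) in *.
  assert (He : 0 <= e) by apply Cmod_ge_0.
  assert (A1 : Cmod (F w - F z - l * (w - z))%C * (Cmod (/ F w)%C * / m) <= eps / 2 * e).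
  { apply Rle_trans with ((eps * (m * m) / 4 * e) * (2 * / m * / m)).
    - apply Rmult_le_compat; [apply Cmod_ge_0 | | exact H2 | ].
      + apply Rmult_le_pos; [apply Cmod_ge_0 | lra].
      + apply Rmult_le_compat_r; lra.
    - right. field. lra. }
  assert (A2 : L * / m * e * Cmod (/ F w - / F z)%C <= eps / 2 * e).
  { apply Rle_trans with (L * / m * e * (eps * (m / (2 * (1 + L))))).
    - apply Rmult_le_compat_l; [|lra]. apply Rmult_le_pos; [nra|lra].
    - replace (L * / m * e * (eps * (m / (2 * (1 + L))))) with ((eps / 2 * e) * (L / (1 + L)))
        by (field; lra).
      rewrite <- (Rmult_1_r (eps / 2 * e)) at 2. apply Rmult_le_compat_l; [nra|].
      apply Rmult_le_reg_r with (1 + L); [lra|]. unfold Rdiv.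
      rewrite Rmult_assoc, Rinv_l; lra. }
  lra.
Qed.

(** Holomorphy near a point.  The continuity of the derivative is part of the definition
    because circle means are differentiated under the integral sign. *)
Definition holo_at (F : C -> C) (z : C) : Prop :=
  exists F' : C -> C,
    locally (T := Cmod_top) z (fun w => is_Cderive F w (F' w)) /\ Ccontinuous F' z.

Lemma holo_at_is_derive (F : C -> C) (z : C) :
  holo_at F z -> is_Cderive F z (C_derive F z).
Proof.
  intros [F' [H _]]. apply (locally_singleton (T := Cmod_top)) in H.
  rewrite (C_derive_unique _ _ _ H). exact H.
Qed.

Lemma holo_at_continuous_derive (F : C -> C) (z : C) :
  holo_at F z -> Ccontinuous (C_derive F) z.
Proof.
  intros [F' [H Hc]].
  apply (continuous_ext_loc (T := Cmod_top) (U := Cmod_top) _ F'); [|exact Hc].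
  apply (filter_imp (F := locally (T := Cmod_top) z)) with (2 := H).
  intros w Hw. symmetry. apply C_derive_unique. exact Hw.
Qed.

Lemma holo_at_continuous (F : C -> C) (z : C) : holo_at F z -> Ccontinuous F z.
Proof.
  intros H. eapply is_Cderive_Ccontinuous. apply holo_at_is_derive. exact H.
Qed.

Lemma holo_at_ext_loc (F G : C -> C) (z : C) :
  locally (T := Cmod_top) z (fun w => F w = G w) -> holo_at F z -> holo_at G z.
Proof.
  intros E [F' [H Hc]]. exists F'. split; [|exact Hc].
  apply (locally_locally (T := Cmod_top)) in E.
  generalize (filter_and (F := locally (T := Cmod_top) z) _ _ E H).
  apply filter_imp. intros w [Ew Hw].
  apply (is_derive_ext_loc (K := C_AbsRing) (V := AbsRing_NormedModule C_AbsRing) F); assumption.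
Qed.

Lemma holo_at_ext (F G : C -> C) (z : C) :
  (forall w, F w = G w) -> holo_at F z -> holo_at G z.
Proof.
  intros E. apply holo_at_ext_loc. apply filter_forall. exact E.
Qed.

Lemma holo_at_const (c z : C) : holo_at (fun _ => c) z.
Proof.
  exists (fun _ => RtoC 0). split.
  - apply filter_forall. intros w. apply (is_derive_const (K := C_AbsRing) (V := AbsRing_NormedModule C_AbsRing)).
  - apply (continuous_const (U := Cmod_top) (V := Cmod_top)).
Qed.

Lemma holo_at_id (z : C) : holo_at (fun w => w) z.
Proof.
  exists (fun _ => RtoC 1). split.
  - apply filter_forall. intros w. apply (is_derive_id (K := C_AbsRing)).
  - apply (continuous_const (U := Cmod_top) (V := Cmod_top)).
Qed.

Lemma holo_at_plus (F G : C -> C) (z : C) :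
  holo_at F z -> holo_at G z -> holo_at (fun w => F w + G w)%C z.
Proof.
  intros [F' [HF CF]] [G' [HG CG]]. exists (fun w => F' w + G' w)%C. split.
  - generalize (filter_and (F := locally (T := Cmod_top) z) _ _ HF HG).
    apply filter_imp. intros w [H1 H2].
    exact (is_derive_plus (K := C_AbsRing) (V := AbsRing_NormedModule C_AbsRing) _ _ _ _ _ H1 H2).
  - exact (continuous_plus (U := Cmod_top) (V := AbsRing_NormedModule C_AbsRing) _ _ _ CF CG).
Qed.

Lemma holo_at_mult (F G : C -> C) (z : C) :
  holo_at F z -> holo_at G z -> holo_at (fun w => F w * G w)%C z.
Proof.
  intros HF HG.
  assert (cF := holo_at_continuous _ _ HF). assert (cG := holo_at_continuous _ _ HG).
  destruct HF as [F' [HF CF]]. destruct HG as [G' [HG CG]].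
  exists (fun w => F' w * G w + F w * G' w)%C. split.
  - generalize (filter_and (F := locally (T := Cmod_top) z) _ _ HF HG).
    apply filter_imp. intros w [H1 H2]. apply is_Cderive_mult; assumption.
  - apply (continuous_plus (U := Cmod_top) (V := AbsRing_NormedModule C_AbsRing)
             (fun w => F' w * G w)%C (fun w => F w * G' w)%C);
      apply (continuous_mult (U := Cmod_top) (K := C_AbsRing)); assumption.
Qed.

Lemma holo_at_scal (c : C) (F : C -> C) (z : C) :
  holo_at F z -> holo_at (fun w => c * F w)%C z.
Proof. intros H. apply holo_at_mult; [apply holo_at_const | exact H]. Qed.

Lemma holo_at_minus (F G : C -> C) (z : C) :
  holo_at F z -> holo_at G z -> holo_at (fun w => F w - G w)%C z.
Proof.
  intros HF HG. apply (holo_at_ext (fun w => F w + (- (1)) * G w)%C).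
  - intros w. ring.
  - apply holo_at_plus; [exact HF | apply holo_at_scal; exact HG].
Qed.

Lemma holo_at_pow (F : C -> C) (n : nat) (z : C) :
  holo_at F z -> holo_at (fun w => F w ^ n)%C z.
Proof.
  intros HF. induction n as [|n IH]; simpl.
  - apply holo_at_const.
  - apply holo_at_mult; assumption.
Qed.

Lemma holo_at_inv (F : C -> C) (z : C) :
  holo_at F z -> F z <> 0 -> holo_at (fun w => / F w)%C z.
Proof.
  intros HF Hz. assert (cF := holo_at_continuous _ _ HF).
  destruct HF as [F' [HF CF]].
  assert (Hnz : locally (T := Cmod_top) z (fun w => F w <> 0)).
  { apply locally_Cmod.
    destruct (proj1 (Ccontinuous_eps F z) cF (Cmod (F z)) (proj1 (Cmod_gt_0 _) Hz))
      as [d [Hd H]].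
    exists d. split; [exact Hd|]. intros w Hw E. specialize (H w Hw). rewrite E in H.
    replace (0 - F z)%C with (- F z)%C in H by ring. rewrite Cmod_opp in H. lra. }
  exists (fun w => (- (1)) * F' w * / (F w * F w))%C. split.
  - generalize (filter_and (F := locally (T := Cmod_top) z) _ _ HF Hnz).
    apply filter_imp. intros w [H1 H2].
    replace ((- (1)) * F' w * / (F w * F w))%C with (- F' w / (F w * F w))%C
      by (unfold Cdiv; ring).
    apply is_Cderive_inv; assumption.
  - apply (continuous_mult (U := Cmod_top) (K := C_AbsRing)
             (fun w => (- (1)) * F' w)%C (fun w => / (F w * F w))%C).
    + apply (continuous_mult (U := Cmod_top) (K := C_AbsRing) (fun w => (- (1))%C) F');
        [apply (continuous_const (U := Cmod_top) (V := Cmod_top)) | exact CF].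
    + apply (Ccontinuous_inv (fun w => F w * F w)%C).
      * apply (continuous_mult (U := Cmod_top) (K := C_AbsRing)); assumption.
      * apply Cmult_neq_0; assumption.
Qed.

(** * Power series and their derivatives *)

Notation is_Cseries := (is_series (K := C_AbsRing) (V := C_NormedModule)).
Notation is_Cpseries := (is_pseries (K := C_AbsRing) (V := C_NormedModule)).
Notation Csum := (sum_n (G := C_AbelianMonoid)).

(** Sums and limits of series have the carrier of a module as their type, where [ring]
    does not recognize the field [C]. *)
Ltac ceq := match goal with |- ?x = ?y => change (@eq C x y) end.

Lemma pow_n_Cpow (z : C) (n : nat) : pow_n (K := C_Ring) z n = (z ^ n)%C.
Proof. induction n as [|n IH]; simpl; [reflexivity | rewrite IH; reflexivity]. Qed.

Lemma is_Cpseries_series (A : nat -> C) (z l : C) :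
  is_Cpseries A z l <-> is_Cseries (fun n => A n * z ^ n)%C l.
Proof.
  unfold is_pseries.
  split; apply is_series_ext; intros n; rewrite <- pow_n_Cpow;
    [apply Cmult_comm | symmetry; apply Cmult_comm].
Qed.

Lemma is_Cseries_unique (u : nat -> C) (l l' : C) :
  is_Cseries u l -> is_Cseries u l' -> l = l'.
Proof.
  intros H H'.
  exact (filterlim_locally_unique (V := C_NormedModule) (F := eventually) _ _ _ H H').
Qed.

Lemma is_Cseries_zero : is_Cseries (fun _ => RtoC 0) (RtoC 0).
Proof.
  intros P HP. exists 0%nat. intros n _.
  change (sum_n (G := C_NormedModule) (fun _ => RtoC 0) n)
    with (sum_n_m (G := C_AbelianMonoid) (fun _ => zero) 0 n).
  rewrite (sum_n_m_const_zero (G := C_AbelianMonoid)). exact (locally_singleton _ _ HP).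
Qed.

Lemma is_Cpseries_zero (A : nat -> C) (z l : C) :
  (forall n, A n = 0) -> is_Cpseries A z l -> l = 0.
Proof.
  intros HA H. apply is_Cpseries_series in H.
  apply (is_Cseries_unique _ _ _ H).
  apply (is_series_ext (K := C_AbsRing) (V := C_NormedModule) (fun _ => RtoC 0)).
  - intros n. rewrite HA. ceq. ring.
  - apply is_Cseries_zero.
Qed.

Lemma is_Cseries_Cmod_le (u : nat -> C) (v : nat -> R) (l : C) (L : R) :
  is_Cseries u l -> (forall n, Cmod (u n) <= v n) -> is_series v L -> Cmod l <= L.
Proof.
  intros Hu Huv Hv.
  assert (Hn : is_lim_seq (fun n => Cmod (sum_n u n)) (Cmod l)).
  { apply (filterlim_comp _ _ _ (sum_n u) Cmod eventually (locally l)); [exact Hu|].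
    exact (filterlim_norm (V := C_NormedModule) l). }
  refine (is_lim_seq_le _ _ (Cmod l) L _ Hn Hv).
  intros n. apply Rle_trans with (sum_n (fun k => Cmod (u k)) n).
  - exact (norm_sum_n_m (V := C_NormedModule) u 0 n).
  - apply sum_n_m_le. exact Huv.
Qed.

Lemma ex_Cseries_Cmod (u : nat -> C) :
  ex_series (fun n => Cmod (u n)) -> exists l : C, is_Cseries u l.
Proof.
  intros H. apply (ex_series_le (K := C_AbsRing) (V := C_CompleteNormedModule) u) in H.
  - exact H.
  - intros n. apply Rle_refl.
Qed.

(** Convergence at [z] bounds the terms of the series, and boundedness is all that the
    radius of convergence of the real series of moduli depends on. *)
Lemma CV_radius_Cmod (A : nat -> C) (z l : C) :
  is_Cpseries A z l -> Rbar_le (Cmod z) (CV_radius (fun n => Cmod (A n))).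
Proof.
  intros H. apply is_Cpseries_series in H.
  assert (Hb : exists M, forall n, Cmod (A n * z ^ n)%C <= M).
  { destruct (filterlim_bounded (V := C_NormedModule) _ (ex_intro _ l H)) as [M HM].
    exists (2 * M). intros n. set (u := fun n => (A n * z ^ n)%C) in *.
    assert (M0 : 0 <= M) by (eapply Rle_trans; [apply Cmod_ge_0 | apply (HM 0%nat)]).
    change (Cmod (u n) <= 2 * M). destruct n as [|n].
    - specialize (HM 0%nat). rewrite sum_O in HM. change (Cmod (u 0%nat) <= M) in HM. lra.
    - assert (H1 := HM n). assert (H2 := HM (S n)). rewrite sum_Sn in H2.
      change (Cmod (Csum u n) <= M) in H1. change (Cmod (Csum u n + u (S n))%C <= M) in H2.
      replace (u (S n)) with ((Csum u n + u (S n)) + - Csum u n)%C by ring.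
      eapply Rle_trans; [apply Cmod_triangle|]. rewrite Cmod_opp. lra. }
  destruct Hb as [M HM].
  apply CV_radius_bounded. exists M. intros n.
  rewrite Rabs_pos_eq.
  - rewrite <- Cmod_pow, <- Cmod_mult. apply HM.
  - apply Rmult_le_pos; [apply Cmod_ge_0 | apply pow_le, Cmod_ge_0].
Qed.

Definition has_expansion (F : C -> C) (z0 : C) (rho : R) (A : nat -> C) : Prop :=
  forall z : C, Cmod (z - z0)%C < rho -> is_Cpseries A (z - z0)%C (F z).

Lemma has_expansion_radius (F : C -> C) (z0 : C) (rho : R) (A : nat -> C) (s : R) :
  has_expansion F z0 rho A -> 0 <= s < rho -> 
  Rbar_lt (Rabs s) (CV_radius (fun n => Cmod (A n))).
Proof.
  intros H Hs. rewrite Rabs_pos_eq by lra.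
  apply Rbar_lt_le_trans with ((s + rho) / 2); [simpl; lra|].
  assert (E : Cmod ((z0 + RtoC ((s + rho) / 2)) - z0)%C = (s + rho) / 2).
  { replace ((z0 + RtoC ((s + rho) / 2)) - z0)%C with (RtoC ((s + rho) / 2)) by ring.
    rewrite Cmod_R. apply Rabs_pos_eq. lra. }
  rewrite <- E at 1. eapply CV_radius_Cmod. apply H. rewrite E. lra.
Qed.

Definition derived_coeffs (A : nat -> C) (n : nat) : C := (RtoC (INR (S n)) * A (S n))%C.

Lemma Cmod_INR (n : nat) : Cmod (RtoC (INR n)) = INR n.
Proof. rewrite Cmod_R. apply Rabs_pos_eq, pos_INR. Qed.

Lemma derived_ex_pseries (F : C -> C) (z0 : C) (rho : R) (A : nat -> C) (z : C) :
  has_expansion F z0 rho A -> Cmod (z - z0)%C < rho ->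
  exists l : C, is_Cpseries (derived_coeffs A) (z - z0)%C l.
Proof.
  intros H Hz.
  assert (Hr := has_expansion_radius _ _ _ _ (Cmod (z - z0)%C) H (conj (Cmod_ge_0 _) Hz)).
  rewrite <- CV_radius_derive in Hr. apply CV_disk_inside in Hr.
  destruct (ex_Cseries_Cmod (fun n => derived_coeffs A n * (z - z0) ^ n)%C) as [l Hl].
  - eapply ex_series_ext; [|exact Hr]. intros n. simpl.
    unfold PS_derive, derived_coeffs.
    rewrite Rabs_pos_eq.
    + rewrite !Cmod_mult, Cmod_INR, Cmod_pow. reflexivity.
    + apply Rmult_le_pos; [apply Rmult_le_pos; [apply pos_INR | apply Cmod_ge_0]
                          | apply pow_le, Cmod_ge_0].
  - exists l. apply is_Cpseries_series. exact Hl.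
Qed.

(** The second-order remainder of [z^(n+2)].  The constant is twice the optimal one, so
    that it matches the coefficients of a series derived twice. *)
Lemma Cmod_pow_taylor2 (w z : C) (s : R) (n : nat) :
  Cmod w <= s -> Cmod z <= s ->
  Cmod (w ^ (S (S n)) - z ^ (S (S n)) - RtoC (INR (S (S n))) * z ^ (S n) * (w - z))%C
  <= INR (S n) * INR (S (S n)) * s ^ n * (Cmod (w - z)%C * Cmod (w - z)%C).
Proof.
  intros Hw Hz. assert (Hs : 0 <= s) by (eapply Rle_trans; [apply Cmod_ge_0 | exact Hz]).
  induction n as [|n IH].
  - simpl (INR _).
    replace (w ^ 2 - z ^ 2 - RtoC (1 + 1) * z ^ 1 * (w - z))%C with ((w - z) * (w - z))%C.
    + rewrite Cmod_mult. generalize (Cmod (w - z)%C). intros e. simpl. nra.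
    + rewrite RtoC_plus. simpl. ring.
  - set (D := (w ^ S (S n) - z ^ S (S n) - RtoC (INR (S (S n))) * z ^ S n * (w - z))%C) in *.
    replace (w ^ S (S (S n)) - z ^ S (S (S n))
             - RtoC (INR (S (S (S n)))) * z ^ S (S n) * (w - z))%C
      with (w * D + RtoC (INR (S (S n))) * z ^ S n * ((w - z) * (w - z)))%C.
    2:{ unfold D. rewrite (S_INR (S (S n))), RtoC_plus.
        rewrite !(Cpow_S _ (S (S n))), (Cpow_S z (S n)). ring. }
    eapply Rle_trans; [apply Cmod_triangle|].
    rewrite !Cmod_mult, Cmod_pow, Cmod_INR.
    set (e := Cmod (w - z)%C) in *. assert (0 <= e) by apply Cmod_ge_0.
    assert (Hzn : Cmod z ^ S n <= s ^ S n) by (apply pow_incr; split; [apply Cmod_ge_0 | exact Hz]).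
    assert (Hsn : 0 <= s ^ S n) by (apply pow_le; exact Hs).
    assert (T1 : Cmod w * Cmod D <= s * (INR (S n) * INR (S (S n)) * s ^ n * (e * e)))
      by (apply Rmult_le_compat; try apply Cmod_ge_0; assumption).
    assert (T2 : INR (S (S n)) * Cmod z ^ S n * (e * e) <= INR (S (S n)) * s ^ S n * (e * e)).
    { apply Rmult_le_compat_r; [nra|]. apply Rmult_le_compat_l; [apply pos_INR | exact Hzn]. }
    replace (s * (INR (S n) * INR (S (S n)) * s ^ n * (e * e)))
      with (INR (S n) * INR (S (S n)) * s ^ S n * (e * e)) in T1 by (simpl (s ^ S n); ring).
    assert (Hn := pos_INR n).
    assert (T3 : 0 <= INR (S (S n)) * s ^ S n * (e * e))
      by (apply Rmult_le_pos; [apply Rmult_le_pos; [apply pos_INR | exact Hsn] | nra]).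
    rewrite (S_INR (S (S n))), (S_INR (S n)) in *. rewrite (S_INR n) in *.
    replace ((INR n + 1 + 1) * (INR n + 1 + 1 + 1) * s ^ S n * (e * e))
      with ((INR n + 1) * (INR n + 1 + 1) * s ^ S n * (e * e)
            + 2 * ((INR n + 1 + 1) * s ^ S n * (e * e))) by ring.
    lra.
Qed.

Lemma is_Cseries_shift (u : nat -> C) (l : C) :
  is_Cseries u l <-> is_Cseries (fun k => u (S k)) (l - u 0%nat)%C.
Proof.
  split; intros H.
  - apply (is_series_incr_1 (K := C_AbsRing) (V := C_NormedModule)).
    match goal with |- is_series _ ?x => replace x with l end; [exact H|].
    unfold plus; simpl. ring.
  - apply (is_series_decr_1 (K := C_AbsRing) (V := C_NormedModule)). exact H.
Qed.

(** Termwise differentiation: the second-order remainders of the powers add up, and they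
    are dominated by the twice derived series of the moduli [|A_n|]. *)
Lemma is_Cpseries_Cderive (F : C -> C) (z0 : C) (rho : R) (A : nat -> C) (z l : C) :
  has_expansion F z0 rho A -> Cmod (z - z0)%C < rho ->
  is_Cpseries (derived_coeffs A) (z - z0)%C l -> is_Cderive F z l.
Proof.
  intros H Hz Hl.
  set (s := (Cmod (z - z0)%C + rho) / 2).
  assert (Hs : 0 <= s < rho) by (unfold s; generalize (Cmod_ge_0 (z - z0)%C); lra).
  assert (Hzs : Cmod (z - z0)%C < s) by (unfold s; lra).
  assert (Hr := has_expansion_radius _ _ _ _ s H Hs).
  rewrite <- CV_radius_derive, <- CV_radius_derive in Hr. apply CV_disk_inside in Hr.
  destruct Hr as [K HK].
  assert (HK' : is_series (fun n => Cmod (A (S (S n))) * (INR (S n) * INR (S (S n)) * s ^ n)) K).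
  { eapply is_series_ext; [|exact HK]. intros n. unfold PS_derive.
    rewrite Rabs_pos_eq.
    { unfold PS_derive. match goal with |- ?a = ?b => change (@eq R a b) end. ring. }
    repeat apply Rmult_le_pos; try apply pos_INR; [apply Cmod_ge_0 | apply pow_le; lra]. }
  assert (K0 : 0 <= K).
  { apply (is_lim_seq_le (fun _ => 0) _ 0 K) with (2 := is_lim_seq_const 0) (3 := HK').
    intros n. apply Rle_trans with (sum_n (fun _ => 0) n).
    - right. rewrite sum_n_const. ring.
    - apply sum_n_m_le. intros k.
      repeat apply Rmult_le_pos; try apply pos_INR; [apply Cmod_ge_0 | apply pow_le; lra]. }
  apply is_Cderive_eps. intros eps Heps.
  exists (Rmin (s - Cmod (z - z0)%C) (eps / (K + 1))).
  split; [apply Rmin_pos; [lra | apply Rdiv_lt_0_compat; lra]|].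
  intros w Hw.
  assert (Hw1 := Rlt_le_trans _ _ _ Hw (Rmin_l _ _)).
  assert (Hw2 := Rlt_le_trans _ _ _ Hw (Rmin_r _ _)).
  assert (Hws : Cmod (w - z0)%C < s).
  { replace (w - z0)%C with ((w - z) + (z - z0))%C by ring.
    eapply Rle_lt_trans; [apply Cmod_triangle|]. lra. }
  set (u := (w - z0)%C) in *. set (v := (z - z0)%C) in *.
  assert (Ew : (w - z)%C = (u - v)%C) by (unfold u, v; ring).
  assert (Su : is_Cseries (fun n => A n * u ^ n)%C (F w))
    by (apply (proj1 (is_Cpseries_series _ _ _)), H; fold u; lra).
  assert (Sv : is_Cseries (fun n => A n * v ^ n)%C (F z))
    by (apply (proj1 (is_Cpseries_series _ _ _)), H; fold v; lra).
  apply is_Cpseries_series in Hl.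
  apply (proj1 (is_Cseries_shift _ _)) in Su. apply (proj1 (is_Cseries_shift _ _)) in Su.
  apply (proj1 (is_Cseries_shift _ _)) in Sv. apply (proj1 (is_Cseries_shift _ _)) in Sv.
  apply (proj1 (is_Cseries_shift _ _)) in Hl.
  set (e := Cmod (w - z)%C) in *. 
  assert (S1 := is_series_minus (K := C_AbsRing) (V := C_NormedModule) _ _ _ _ Su Sv).
  assert (S2 := is_series_scal (K := C_AbsRing) (V := C_NormedModule) (w - z)%C _ _ Hl).
  assert (S3 := is_series_minus (K := C_AbsRing) (V := C_NormedModule) _ _ _ _ S1 S2).
  assert (Hb : Cmod (F w - F z - l * (w - z))%C <= K * (e * e)).
  { replace (F w - F z - l * (w - z))%C with
      (plus (plus (F w - A 0%nat * u ^ 0 - A 1%nat * u ^ 1)%C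
              (opp (F z - A 0%nat * v ^ 0 - A 1%nat * v ^ 1)%C))
        (opp (scal (w - z)%C (l - derived_coeffs A 0 * v ^ 0)%C))).
    2:{ unfold plus, opp, scal; simpl. unfold mult; simpl. rewrite Ew.
        unfold derived_coeffs. simpl. ring. }
    eapply is_Cseries_Cmod_le; [exact S3 | | apply is_series_scal_r, HK'].
    intros n. cbv beta.
    match goal with |- Cmod ?X <= _ =>
      replace X with (A (S (S n)) * (u ^ S (S n) - v ^ S (S n)
          - RtoC (INR (S (S n))) * v ^ S n * (u - v)))%C end.
    2:{ unfold plus, opp, scal; simpl. unfold mult; simpl. rewrite Ew.
        unfold derived_coeffs. simpl. ring. }
    rewrite Cmod_mult, Rmult_assoc. apply Rmult_le_compat_l; [apply Cmod_ge_0|].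
    unfold e. rewrite Ew. apply Cmod_pow_taylor2; lra. }
  eapply Rle_trans; [exact Hb|].
  assert (0 <= e) by apply Cmod_ge_0.
  assert (K * e <= eps).
  { apply Rle_trans with ((K + 1) * e); [nra|].
    apply Rmult_lt_compat_l with (r := K + 1) in Hw2; [|lra].
    replace ((K + 1) * (eps / (K + 1))) with eps in Hw2 by (field; lra). lra. }
  nra.
Qed.

Lemma has_expansion_derive (F : C -> C) (z0 : C) (rho : R) (A : nat -> C) :
  has_expansion F z0 rho A -> has_expansion (C_derive F) z0 rho (derived_coeffs A).
Proof.
  intros H z Hz. destruct (derived_ex_pseries _ _ _ _ z H Hz) as [l Hl].
  rewrite (C_derive_unique F z l); [exact Hl|].
  eapply is_Cpseries_Cderive; eassumption.
Qed.

Lemma has_expansion_is_derive (F : C -> C) (z0 : C) (rho : R) (A : nat -> C) (z : C) :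
  has_expansion F z0 rho A -> Cmod (z - z0)%C < rho -> is_Cderive F z (C_derive F z).
Proof.
  intros H Hz. eapply is_Cpseries_Cderive; [exact H | exact Hz|].
  exact (has_expansion_derive _ _ _ _ H z Hz).
Qed.

Lemma has_expansion_holo (F : C -> C) (z0 : C) (rho : R) (A : nat -> C) (z : C) :
  has_expansion F z0 rho A -> Cmod (z - z0)%C < rho -> holo_at F z.
Proof.
  intros H Hz. exists (C_derive F). split.
  - apply locally_Cmod. exists (rho - Cmod (z - z0)%C). split; [lra|].
    intros w Hw. apply (has_expansion_is_derive _ _ _ _ _ H).
    replace (w - z0)%C with ((w - z) + (z - z0))%C by ring.
    eapply Rle_lt_trans; [apply Cmod_triangle|]. lra.
  - apply (is_Cderive_Ccontinuous _ _ (C_derive (C_derive F) z)).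
    eapply has_expansion_is_derive; [apply has_expansion_derive; exact H | exact Hz].
Qed.

(** * Taylor remainders, zeros and uniqueness of expansions *)

Lemma has_expansion_center (F : C -> C) (z0 : C) (rho : R) (A : nat -> C) :
  0 < rho -> has_expansion F z0 rho A -> F z0 = A 0%nat.
Proof.
  intros Hr H.
  specialize (H z0 (center_in_ball z0 rho Hr)). replace (z0 - z0)%C with (RtoC 0) in H by ring.
  apply is_Cpseries_series in H.
  apply (is_Cseries_unique _ _ _ H).
  apply (proj1 (is_Cpseries_series _ _ _)), (is_pseries_0 (K := C_AbsRing) (V := C_NormedModule)).
Qed.

Lemma has_expansion_tail (F : C -> C) (z0 : C) (rho : R) (A : nat -> C) :
  0 < rho -> has_expansion F z0 rho A ->
  exists F1 : C -> C, has_expansion F1 z0 rho (fun k => A (S k)) /\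
    forall z, Cmod (z - z0)%C < rho -> F z = (A 0%nat + (z - z0) * F1 z)%C.
Proof.
  intros Hr H.
  exists (fun z => if Ceq_dec z z0 then A 1%nat else ((F z - A 0%nat) / (z - z0))%C).
  split.
  - intros z Hz. destruct (Ceq_dec z z0) as [E|E].
    + subst z. replace (z0 - z0)%C with (RtoC 0) by ring.
      exact (is_pseries_0 (K := C_AbsRing) (V := C_NormedModule) (fun k => A (S k))).
    + assert (Hn : (z - z0)%C <> 0) by (intros E'; apply E, Ceq_minus, E').
      specialize (H z Hz). apply (proj1 (is_Cpseries_series _ _ _)) in H. apply (proj1 (is_Cseries_shift _ _)) in H.
      apply (is_series_scal (K := C_AbsRing) (V := C_NormedModule) (/ (z - z0))%C) in H.
      apply is_Cpseries_series.
      match type of H with is_series _ ?x =>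
        replace x with ((F z - A 0%nat) / (z - z0))%C in H end.
      2:{ unfold scal; simpl. unfold mult; simpl. field. exact Hn. }
      eapply is_series_ext; [|exact H]. intros n.
      unfold scal; simpl. unfold mult; simpl. field. exact Hn.
  - intros z Hz. destruct (Ceq_dec z z0) as [E|E].
    + subst z. rewrite (has_expansion_center _ _ _ _ Hr H). ring.
    + field. intros E'; apply E, Ceq_minus, E'.
Qed.

Lemma has_expansion_taylor (F : C -> C) (z0 : C) (rho : R) (A : nat -> C) (n : nat) :
  0 < rho -> has_expansion F z0 rho A ->
  exists Fn : C -> C, has_expansion Fn z0 rho (fun k => A (S n + k)%nat) /\
    forall z, Cmod (z - z0)%C < rho ->
      F z = (Csum (fun k => A k * (z - z0) ^ k) n + (z - z0) ^ S n * Fn z)%C.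
Proof.
  intros Hr H. induction n as [|n [Fn [Hn En]]].
  - destruct (has_expansion_tail _ _ _ _ Hr H) as [F1 [H1 E1]].
    exists F1. split; [exact H1|]. intros z Hz. rewrite sum_O, (E1 z Hz). simpl. ring.
  - destruct (has_expansion_tail _ _ _ _ Hr Hn) as [F1 [H1 E1]].
    exists F1. split.
    + intros z Hz. eapply (is_pseries_ext (K := C_AbsRing) (V := C_NormedModule)); [|exact (H1 z Hz)].
      intros k. simpl. f_equal. lia.
    + intros z Hz. rewrite (En z Hz), (E1 z Hz), sum_Sn.
      replace (S n + 0)%nat with (S n) by lia.
      unfold plus; simpl. ring.
Qed.

Lemma has_expansion_factor (F : C -> C) (z0 : C) (rho : R) (A : nat -> C) (p : nat) :
  0 < rho -> has_expansion F z0 rho A -> (forall k, (k < p)%nat -> A k = 0) ->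
  exists G : C -> C, has_expansion G z0 rho (fun k => A (p + k)%nat) /\
    forall z, Cmod (z - z0)%C < rho -> F z = ((z - z0) ^ p * G z)%C.
Proof.
  intros Hr H H0. destruct p as [|p].
  - exists F. split; [exact H|]. intros z _. simpl. ring.
  - destruct (has_expansion_taylor _ _ _ _ p Hr H) as [G [HG EG]].
    exists G. split; [exact HG|]. intros z Hz. rewrite (EG z Hz).
    rewrite (sum_n_ext_loc (G := C_AbelianMonoid) _ (fun _ => RtoC 0)).
    + change (Csum (fun _ => RtoC 0) p)
        with (sum_n_m (G := C_AbelianMonoid) (fun _ => zero) 0 p).
      rewrite (sum_n_m_const_zero (G := C_AbelianMonoid)).
      change (@zero C_AbelianMonoid) with (RtoC 0). ring.
    + intros k Hk. rewrite H0 by lia. apply Cmult_0_l.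
Qed.

(** The exact order of vanishing is the first index with a nonzero coefficient. *)
Lemma has_expansion_order (F : C -> C) (z0 : C) (rho : R) (A : nat -> C) :
  0 < rho -> has_expansion F z0 rho A -> (exists n, A n <> 0) ->
  exists (p : nat) (G : C -> C) (d : R), 
    0 < d <= rho /\ (exists B, has_expansion G z0 rho B) /\
    (forall k, (k < p)%nat -> A k = 0) /\
    forall z, Cmod (z - z0)%C < d -> G z <> 0 /\ F z = ((z - z0) ^ p * G z)%C.
Proof.
  intros Hr H Hex.
  destruct (dec_inh_nat_subset_has_unique_least_element (fun n => A n <> 0)
     (fun n => classic _) Hex) as [p [[Hp Hmin] _]].
  assert (H0 : forall k, (k < p)%nat -> A k = 0).
  { intros k Hk. apply NNPP. intros Hn. specialize (Hmin k Hn). lia. }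
  destruct (has_expansion_factor _ _ _ _ p Hr H H0) as [G [HG EG]].
  assert (G0 : G z0 = A p).
  { rewrite (has_expansion_center _ _ _ _ Hr HG). f_equal. lia. }
  assert (Hz0 := center_in_ball z0 rho Hr).
  assert (Gc := holo_at_continuous _ _ (has_expansion_holo _ _ _ _ _ HG Hz0)).
  assert (Hpos : 0 < Cmod (G z0)) by (apply Cmod_gt_0; rewrite G0; exact Hp).
  destruct (proj1 (Ccontinuous_eps _ _) Gc _ Hpos) as [d [Hd Hdz]].
  exists p, G, (Rmin d rho). split; [split; [apply Rmin_pos; assumption | apply Rmin_r]|].
  split; [exists (fun k => A (p + k)%nat); exact HG|].
  split; [exact H0|]. intros z Hz. split.
  - intros E. specialize (Hdz z (Rlt_le_trans _ _ _ Hz (Rmin_l _ _))). rewrite E in Hdz.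
    replace (0 - G z0)%C with (- G z0)%C in Hdz by ring. rewrite Cmod_opp in Hdz. lra.
  - apply EG. exact (Rlt_le_trans _ _ _ Hz (Rmin_r _ _)).
Qed.

(** Zeros are isolated: near [z0] a nonzero series is a power of [z - z0] times a function
    without zeros. *)
Lemma has_expansion_isolated_zeros (F : C -> C) (z0 : C) (rho : R) (A : nat -> C) :
  0 < rho -> has_expansion F z0 rho A ->
  (forall d, 0 < d -> exists z, 0 < Cmod (z - z0)%C < d /\ F z = 0) ->
  forall n, A n = 0.
Proof.
  intros Hr H Hacc n. apply NNPP. intros Hn.
  destruct (has_expansion_order _ _ _ _ Hr H (ex_intro _ n Hn)) as [p [G [d [[Hd _] [_ [_ Hz]]]]]].
  destruct (Hacc d Hd) as [z [[Hz1 Hz2] Ez]].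
  destruct (Hz z Hz2) as [Gz Fz]. rewrite Fz in Ez.
  apply (Cmult_neq_0 ((z - z0) ^ p) (G z))%C; [|exact Gz|exact Ez].
  apply Cpow_nz. apply Cmod_gt_0. exact Hz1.
Qed.

Lemma has_expansion_unique (F : C -> C) (z0 : C) (rho : R) (A B : nat -> C) :
  0 < rho -> has_expansion F z0 rho A -> has_expansion F z0 rho B ->
  forall n, A n = B n.
Proof.
  intros Hr HA HB n. apply Ceq_minus.
  apply (has_expansion_isolated_zeros (fun _ => RtoC 0) z0 rho (fun n => A n - B n)%C Hr).
  - intros z Hz.
    assert (H := is_pseries_minus (K := C_AbsRing) (V := C_NormedModule) _ _ _ _ _ (HA z Hz) (HB z Hz)).
    match type of H with is_pseries _ _ ?x => replace x with (RtoC 0) in H end.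
    + exact H.
    + unfold plus, opp; simpl. ring.
  - intros d Hd. destruct (Cmod_lt_exists z0 d Hd) as [z Hz]. exists z. split; [exact Hz | reflexivity].
Qed.

Lemma expansion_in_disk_has_expansion (F : C -> C) (A : nat -> C) :
  expansion_in_disk F A <-> has_expansion F 0 1 A.
Proof.
  split; intros H z Hz.
  - replace (z - 0)%C with z in * by ring. apply H. exact Hz.
  - unfold in_disk in Hz. replace z with (z - 0)%C at 1 by ring. apply H.
    replace (z - 0)%C with z by ring. exact Hz.
Qed.

Lemma coeffs_unique (F : C -> C) (A : nat -> C) (n : nat) :
  expansion_in_disk F A -> coeffs F n = A n.
Proof.
  intros H.
  assert (Hc : expansion_in_disk F (coeffs F)).
  { unfold coeffs. apply epsilon_spec. exists A. exact H. }
  apply (has_expansion_unique F 0 1); [lra | |]; apply expansion_in_disk_has_expansion; assumption.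
Qed.

Lemma majorant_series_derive (F : C -> C) (A : nat -> C) (r : R) :
  expansion_in_disk F A -> 0 <= r < 1 ->
  is_series (fun n => INR (S n) * Cmod (A (S n)) * r ^ n) (majorant_series (C_derive F) r).
Proof.
  intros H Hr. apply expansion_in_disk_has_expansion in H.
  assert (HD := has_expansion_derive _ _ _ _ H).
  apply expansion_in_disk_has_expansion in HD.
  assert (E : forall n, Cmod (coeffs (C_derive F) n) * r ^ n = INR (S n) * Cmod (A (S n)) * r ^ n).
  { intros n. rewrite (coeffs_unique _ _ n HD). unfold derived_coeffs.
    rewrite Cmod_mult, Cmod_INR. reflexivity. }
  apply (is_series_ext (fun n => Cmod (coeffs (C_derive F) n) * r ^ n)); [exact E|].
  apply Series_correct.
  assert (Hr' := has_expansion_radius _ _ _ _ r H Hr).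
  rewrite <- CV_radius_derive in Hr'. apply CV_disk_inside in Hr'.
  eapply ex_series_ext; [|exact Hr']. intros n. cbv beta. rewrite E. unfold PS_derive.
  apply Rabs_pos_eq.
  repeat apply Rmult_le_pos; [apply pos_INR | apply Cmod_ge_0 | apply pow_le; lra].
Qed.

(** The origin is excluded because quotients such as [phi z / z] carry no information
    there. *)
Definition bigO0 (F : C -> C) (n : nat) : Prop :=
  exists M d : R, 0 < d /\ forall z : C, 0 < Cmod z < d -> Cmod (F z) <= M * Cmod z ^ n.

Lemma has_expansion_remainder (F : C -> C) (rho : R) (A : nat -> C) (n : nat) :
  0 < rho -> has_expansion F 0 rho A ->
  exists M d : R, 0 <= M /\ 0 < d /\ forall z : C, Cmod z < d ->
    Cmod (F z - Csum (fun k => A k * z ^ k) n)%C <= M * Cmod z ^ S n.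
Proof.
  intros Hr H. destruct (has_expansion_taylor _ _ _ _ n Hr H) as [G [HG EG]].
  assert (H0 := center_in_ball 0 rho Hr).
  assert (Gc := holo_at_continuous _ _ (has_expansion_holo _ _ _ _ _ HG H0)).
  destruct (proj1 (Ccontinuous_eps _ _) Gc 1 Rlt_0_1) as [d [Hd Hdz]].
  exists (1 + Cmod (G 0)), (Rmin d rho).
  split; [generalize (Cmod_ge_0 (G 0)); lra|]. split; [apply Rmin_pos; assumption|].
  intros z Hz.
  assert (Hz1 := Rlt_le_trans _ _ _ Hz (Rmin_l _ _)).
  assert (Hz2 := Rlt_le_trans _ _ _ Hz (Rmin_r _ _)).
  assert (Ez : (z - 0)%C = z) by ring.
  specialize (Hdz z). specialize (EG z). rewrite Ez in *.
  rewrite (EG Hz2).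
  match goal with |- Cmod ?X <= _ => replace X with (z ^ S n * G z)%C by ring end.
  rewrite Cmod_mult, Cmod_pow, Rmult_comm.
  apply Rmult_le_compat_r; [apply pow_le, Cmod_ge_0|].
  specialize (Hdz Hz1). replace (G z) with ((G z - G 0) + G 0)%C by ring.
  eapply Rle_trans; [apply Cmod_triangle|]. lra.
Qed.

(** * Means over circles *)

Definition cis (t theta : R) : C := (t * cos theta, t * sin theta).

Lemma Cmod_cis (t theta : R) : 0 <= t -> Cmod (cis t theta) = t.
Proof.
  intros Ht. unfold Cmod, cis; simpl.
  replace (t * cos theta * (t * cos theta * 1) + t * sin theta * (t * sin theta * 1)) with (t * t).
  - apply sqrt_square. exact Ht.
  - assert (H := sin2_cos2 theta). unfold Rsqr in H. 
    replace (t * cos theta * (t * cos theta * 1) + t * sin theta * (t * sin theta * 1))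
      with (t * t * (sin theta * sin theta + cos theta * cos theta)) by ring.
    rewrite H. ring.
Qed.

Lemma Cmod_le_Rabs (a b : R) : Cmod (a, b) <= Rabs a + Rabs b.
Proof.
  replace (a, b) with (RtoC a + Ci * RtoC b)%C.
  - eapply Rle_trans; [apply Cmod_triangle|].
    rewrite Cmod_mult, Cmod_Ci, !Cmod_R. lra.
  - unfold RtoC, Ci, Cplus, Cmult; simpl. f_equal; ring.
Qed.

Lemma is_derive_eps (f : R -> R) (x l : R) :
  is_derive f x l <->
  forall eps : R, 0 < eps -> exists d : R, 0 < d /\ forall y : R,
    Rabs (y - x) < d -> Rabs (f y - f x - l * (y - x)) <= eps * Rabs (y - x).
Proof.
  split.
  - intros [_ H] eps Heps.
    destruct (H x (fun P HP => HP) (mkposreal eps Heps)) as [d Hd].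
    exists d. split; [apply cond_pos|]. intros y Hy. specialize (Hd y Hy).
    rewrite (Rmult_comm l). exact Hd.
  - intros H. split; [apply (is_linear_scal_l (K := R_AbsRing) (V := R_NormedModule))|].
    intros y Hy.
    assert (Ey : y = x).
    { symmetry. apply (is_filter_lim_locally_unique (V := R_NormedModule)). exact Hy. }
    subst y. intros eps.
    destruct (H eps (cond_pos eps)) as [d [Hd Hw]].
    exists (mkposreal d Hd). intros y Hyx. specialize (Hw y Hyx).
    rewrite (Rmult_comm l) in Hw. exact Hw.
Qed.

Lemma is_derive_Re_curve (G : C -> C) (p q : R -> R) (s p' q' : R) (l : C) :
  is_Cderive G (p s, q s) l -> is_derive p s p' -> is_derive q s q' ->
  is_derive (fun x => Re (G (p x, q x))) s (Re (l * (p', q'))%C).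
Proof.
  intros HG Hp Hq. apply is_derive_eps. intros eps Heps.
  set (L := Cmod l). assert (HL : 0 <= L) by apply Cmod_ge_0.
  set (N := Rabs p' + Rabs q' + 1).
  assert (HN : 1 <= N) by (unfold N; generalize (Rabs_pos p') (Rabs_pos q'); lra).
  set (e1 := eps / (2 * (N + 1))). 
  assert (He1 : 0 < e1) by (unfold e1; apply Rdiv_lt_0_compat; lra).
  set (e2 := Rmin (1 / 2) (eps / (4 * (L + 1)))).
  assert (He2 : 0 < e2) by (unfold e2; apply Rmin_pos; [lra | apply Rdiv_lt_0_compat; lra]).
  destruct (proj1 (is_Cderive_eps _ _ _) HG e1 He1) as [d [Hd HGd]].
  destruct (proj1 (is_derive_eps _ _ _) Hp e2 He2) as [dp [Hdp Hpd]].
  destruct (proj1 (is_derive_eps _ _ _) Hq e2 He2) as [dq [Hdq Hqd]].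
  assert (HdN : 0 < d / N) by (apply Rdiv_lt_0_compat; lra).
  exists (Rmin (d / N) (Rmin dp dq)). split; [repeat apply Rmin_pos; assumption|].
  intros y Hy.
  assert (Hy1 := Rlt_le_trans _ _ _ Hy (Rmin_l _ _)).
  assert (Hy' := Rlt_le_trans _ _ _ Hy (Rmin_r _ _)).
  specialize (Hpd y (Rlt_le_trans _ _ _ Hy' (Rmin_l _ _))).
  specialize (Hqd y (Rlt_le_trans _ _ _ Hy' (Rmin_r _ _))).
  set (h := y - s) in *. set (ah := Rabs h) in *. assert (Hah : 0 <= ah) by apply Rabs_pos.
  assert (He2a : e2 <= 1 / 2) by apply Rmin_l.
  assert (He2b : e2 <= eps / (4 * (L + 1))) by apply Rmin_r.
  (* the curve is its linear part up to [2 * e2 * |h|] *)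
  assert (Hlin : Cmod ((p y, q y) - (p s, q s) - RtoC h * (p', q'))%C <= 2 * e2 * ah).
  { replace ((p y, q y) - (p s, q s) - RtoC h * (p', q'))%C
      with (p y - p s - p' * h, q y - q s - q' * h).
    - eapply Rle_trans; [apply Cmod_le_Rabs|]. lra.
    - unfold RtoC, Cminus, Cplus, Cmult, Copp; simpl. f_equal; ring. }
  assert (Hinc : Cmod ((p y, q y) - (p s, q s))%C <= N * ah).
  { replace ((p y, q y) - (p s, q s))%C
      with (((p y, q y) - (p s, q s) - RtoC h * (p', q')) + RtoC h * (p', q'))%C by ring.
    eapply Rle_trans; [apply Cmod_triangle|].
    rewrite Cmod_mult, Cmod_R. fold ah.
    assert (H1 := Cmod_le_Rabs p' q'). unfold N.
    assert (ah * Cmod (p', q') <= ah * (Rabs p' + Rabs q')) by (apply Rmult_le_compat_l; lra).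
    nra. }
  assert (Hlt : Cmod ((p y, q y) - (p s, q s))%C < d).
  { eapply Rle_lt_trans; [exact Hinc|].
    apply Rmult_lt_compat_l with (r := N) in Hy1; [|lra].
    replace (N * (d / N)) with d in Hy1 by (field; lra). exact Hy1. }
  specialize (HGd (p y, q y) Hlt).
  replace (Re (G (p y, q y)) - Re (G (p s, q s)) - Re (l * (p', q'))%C * h) with
    (Re ((G (p y, q y) - G (p s, q s) - l * ((p y, q y) - (p s, q s)))
         + l * ((p y, q y) - (p s, q s) - RtoC h * (p', q')))%C).
  2:{ replace ((G (p y, q y) - G (p s, q s) - l * ((p y, q y) - (p s, q s)))
         + l * ((p y, q y) - (p s, q s) - RtoC h * (p', q')))%C
       with (G (p y, q y) + - G (p s, q s) + - (RtoC h * (l * (p', q'))))%C by ring.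
      rewrite !re_plus, !re_opp, re_scal_l. ring. }
  eapply Rle_trans; [apply re_le_Cmod|].
  eapply Rle_trans; [apply Cmod_triangle|]. rewrite (Cmod_mult l). fold L.
  assert (T1 : Cmod (G (p y, q y) - G (p s, q s) - l * ((p y, q y) - (p s, q s)))%C <= eps / 2 * ah).
  { eapply Rle_trans; [exact HGd|].
    apply Rle_trans with (e1 * (N * ah)); [apply Rmult_le_compat_l; lra|].
    rewrite <- Rmult_assoc. apply Rmult_le_compat_r; [exact Hah|].
    unfold e1. apply Rmult_le_reg_r with (2 * (N + 1)); [lra|].
    replace (eps / (2 * (N + 1)) * N * (2 * (N + 1))) with (eps * N) by (field; lra). nra. }
  assert (T2 : L * Cmod ((p y, q y) - (p s, q s) - RtoC h * (p', q'))%C <= eps / 2 * ah).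
  { apply Rle_trans with (L * (2 * e2 * ah)); [apply Rmult_le_compat_l; lra|].
    replace (L * (2 * e2 * ah)) with ((L * (2 * e2)) * ah) by ring.
    apply Rmult_le_compat_r; [exact Hah|].
    apply Rle_trans with (L * (2 * (eps / (4 * (L + 1))))); [apply Rmult_le_compat_l; lra|].
    apply Rmult_le_reg_r with (4 * (L + 1)); [lra|].
    replace (L * (2 * (eps / (4 * (L + 1)))) * (4 * (L + 1))) with (2 * L * eps) by (field; lra).
    nra. }
  lra.
Qed.

Lemma continuous_Cpair (T : UniformSpace) (f g : T -> R) (x : T) :
  continuous f x -> continuous g x ->
  continuous (U := Cmod_top) (fun y => (f y, g y)) x.
Proof.
  intros Hf Hg. apply filterlim_locally. intros eps.
  assert (Hf' := proj1 (filterlim_locally _ _) Hf (pos_div_2 eps)).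
  assert (Hg' := proj1 (filterlim_locally _ _) Hg (pos_div_2 eps)).
  generalize (filter_and _ _ Hf' Hg'). apply filter_imp. intros y [H1 H2].
  change (Cmod ((f y, g y) - (f x, g x))%C < eps).
  change (Rabs (f y - f x) < eps / 2) in H1. change (Rabs (g y - g x) < eps / 2) in H2.
  replace ((f y, g y) - (f x, g x))%C with (f y - f x, g y - g x) by reflexivity.
  eapply Rle_lt_trans; [apply Cmod_le_Rabs|]. lra.
Qed.

Lemma continuous_Re (z : C) : continuous (T := Cmod_top) (U := R_UniformSpace) Re z.
Proof.
  apply filterlim_locally. intros eps. exists eps. intros w Hw.
  change (Cmod (w - z)%C < eps) in Hw. change (Rabs (Re w - Re z) < eps).
  replace (Re w - Re z) with (Re (w - z)%C) by (unfold Cminus; rewrite re_plus, re_opp; ring).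
  eapply Rle_lt_trans; [apply re_le_Cmod | exact Hw].
Qed.

Definition holo_punctured (G : C -> C) : Prop :=
  forall z : C, 0 < Cmod z < 1 -> holo_at G z.

(** The mean of the real part alone: multiplying [G] by a constant of modulus one selects
    any other direction, so that real integrals suffice. *)
Definition circle_mean (G : C -> C) (t : R) : R :=
  RInt (fun theta => Re (G (cis t theta))) 0 (2 * PI) / (2 * PI).


Lemma continuous_cis (T : UniformSpace) (f g : T -> R) (x : T) :
  continuous f x -> continuous g x ->
  continuous (U := Cmod_top) (fun y => cis (f y) (g y)) x.
Proof.
  intros Hf Hg. unfold cis. apply continuous_Cpair.
  - apply (continuous_mult (K := R_AbsRing) f (fun y => cos (g y))); [exact Hf|].
    apply (continuous_comp g cos); [exact Hg | apply continuous_cos].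
  - apply (continuous_mult (K := R_AbsRing) f (fun y => sin (g y))); [exact Hf|].
    apply (continuous_comp g sin); [exact Hg | apply continuous_sin].
Qed.

Lemma continuous_Re_comp (T : UniformSpace) (h : T -> C) (G : C -> C) (x : T) :
  continuous (U := Cmod_top) h x -> Ccontinuous G (h x) ->
  continuous (fun y => Re (G (h y))) x.
Proof.
  intros Hh HG. apply (continuous_comp (V := Cmod_top) (W := R_UniformSpace) h (fun w => Re (G w))); [exact Hh|].
  apply (continuous_comp (U := Cmod_top) (V := Cmod_top) (W := R_UniformSpace) G Re); [exact HG | apply continuous_Re].
Qed.

Lemma circle_continuous (G : C -> C) (t theta : R) :
  Ccontinuous G (cis t theta) -> continuous (fun x => Re (G (cis t x))) theta.
Proof.
  intros H. apply (continuous_Re_comp _ (fun x => cis t x)); [|exact H].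
  apply continuous_cis; [apply continuous_const | apply continuous_id].
Qed.

Lemma circle_ex_RInt (G : C -> C) (t a b : R) :
  holo_punctured G -> 0 < t < 1 -> ex_RInt (fun x => Re (G (cis t x))) a b.
Proof.
  intros HG Ht. apply (ex_RInt_continuous (V := R_CompleteNormedModule)). intros theta _.
  apply circle_continuous, holo_at_continuous, HG. rewrite Cmod_cis; lra.
Qed.

Lemma is_derive_radial (G : C -> C) (t theta : R) (l : C) :
  is_Cderive G (cis t theta) l ->
  is_derive (fun s => Re (G (cis s theta))) t (Re (l * cis 1 theta)%C).
Proof.
  intros H. unfold cis. apply (is_derive_Re_curve G _ _ t); [exact H | |];
    auto_derive; trivial; ring.
Qed.

(** The imaginary part of [G] is written as the real part of [- Ci * G]. *)
Lemma is_derive_angular (G : C -> C) (t theta : R) (l : C) :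
  is_Cderive G (cis t theta) l ->
  is_derive (fun x => Re ((- Ci) * G (cis t x))%C) theta (t * Re (l * cis 1 theta)%C).
Proof.
  intros H.
  assert (H' : is_Cderive (fun w => (- Ci) * G w)%C (cis t theta) ((- Ci) * l)%C).
  { replace ((- Ci) * l)%C with (0 * G (cis t theta) + (- Ci) * l)%C by ring.
    apply (is_Cderive_mult (fun _ => (- Ci)%C)); [|exact H].
    apply (is_derive_const (K := C_AbsRing) (V := AbsRing_NormedModule C_AbsRing)). }
  replace (t * Re (l * cis 1 theta)%C)
    with (Re ((- Ci) * l * (- (t * sin theta), t * cos theta)%R)%C).
  - unfold cis. apply (is_derive_Re_curve (fun w => (- Ci) * G w)%C _ _ theta); [exact H' | |];
      auto_derive; trivial; ring.
  - destruct l as [a b]. unfold Ci, cis, Cmult, Copp, Re; simpl. ring.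
Qed.

Lemma RInt_radial_derivative (G : C -> C) (t : R) :
  holo_punctured G -> 0 < t < 1 ->
  RInt (fun theta => Re (C_derive G (cis t theta) * cis 1 theta)%C) 0 (2 * PI) = 0.
Proof.
  intros HG Ht.
  assert (Hc : forall theta, holo_at G (cis t theta))
    by (intros theta; apply HG; rewrite Cmod_cis; lra).
  apply is_RInt_unique.
  assert (H : is_RInt (fun theta => t * Re (C_derive G (cis t theta) * cis 1 theta)%C) 0 (2 * PI) 0).
  { replace 0 with (minus (Re ((- Ci) * G (cis t (2 * PI)))%C) (Re ((- Ci) * G (cis t 0))%C)) at 2.
    - apply (is_RInt_derive (V := R_CompleteNormedModule) (fun x => Re ((- Ci) * G (cis t x))%C)).
      + intros x _. apply is_derive_angular, holo_at_is_derive, Hc.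
      + intros x _. 
        apply (continuous_mult (K := R_AbsRing) (fun _ => t)
                 (fun theta => Re (C_derive G (cis t theta) * cis 1 theta)%C));
          [apply continuous_const|].
        apply (continuous_comp (U := R_UniformSpace) (V := Cmod_top) (W := R_UniformSpace)
                 (fun theta => C_derive G (cis t theta) * cis 1 theta)%C Re);
          [|apply continuous_Re].
        apply (continuous_mult (K := C_AbsRing) (fun theta => C_derive G (cis t theta)) (fun theta => cis 1 theta)).
        * apply (continuous_comp (U := R_UniformSpace) (V := Cmod_top) (W := Cmod_top) (fun x => cis t x) (C_derive G)).
          -- apply continuous_cis; [apply continuous_const | apply continuous_id].
          -- apply holo_at_continuous_derive, Hc.
        * apply continuous_cis; [apply continuous_const | apply continuous_id].
    - unfold minus, plus, opp; simpl.
      replace (cis t (2 * PI)) with (cis t 0); [ring|].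
      unfold cis. rewrite cos_0, sin_0, cos_2PI, sin_2PI. reflexivity. }
  apply (is_RInt_scal _ _ _ (/ t)) in H.
  apply (is_RInt_ext (V := R_NormedModule)
    (fun theta => scal (/ t) (t * Re (C_derive G (cis t theta) * cis 1 theta)%C))).
  - intros x _. unfold scal; simpl. unfold mult; simpl. 
    match goal with |- ?a = ?b => change (@eq R a b) end. field. lra.
  - replace 0 with (scal (/ t) 0) at 2; [exact H|].
    unfold scal; simpl. unfold mult; simpl. ring.
Qed.

(** Cauchy's theorem for annuli: by the Cauchy-Riemann equations the radial derivative
    of the real part is, up to the factor [t], the angular derivative of the imaginary
    part, which integrates to zero around the circle. *)
Lemma circle_mean_const (G : C -> C) (s t : R) :
  holo_punctured G -> 0 < s < t -> t < 1 -> circle_mean G s = circle_mean G t.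
Proof.
  intros HG Hs Ht. unfold circle_mean. f_equal.
  apply (eq_is_derive (V := R_NormedModule)
    (fun x => RInt (fun theta => Re (G (cis x theta))) 0 (2 * PI))); [|lra].
  intros x Hx.
  assert (Hloc : forall y, 0 < y < 1 -> locally y (fun u : R => 0 < u < 1)).
  { intros y Hy. apply (locally_interval _ y 0 1); simpl; try lra. intros; split; assumption. }
  assert (HD : forall u v, 0 < u < 1 ->
    Derive (fun z => Re (G (cis z v))) u = Re (C_derive G (cis u v) * cis 1 v)%C).
  { intros u v Hu. apply is_derive_unique, is_derive_radial, holo_at_is_derive, HG.
    rewrite Cmod_cis; lra. }
  replace (@zero R_NormedModule) with (RInt (fun theta => Derive (fun u => Re (G (cis u theta))) x) 0 (2 * PI)).
  2:{ etransitivity; [|apply (RInt_radial_derivative G x HG); lra].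
      apply RInt_ext. intros theta _. apply HD. lra. }
  apply (is_derive_RInt_param (fun u theta => Re (G (cis u theta)))).
  - generalize (Hloc x ltac:(lra)). apply filter_imp. intros u Hu theta _.
    eexists. apply is_derive_radial, holo_at_is_derive, HG. rewrite Cmod_cis; lra.
  - intros theta _.
    apply (continuity_2d_pt_ext_loc (fun u v => Re (C_derive G (cis u v) * cis 1 v)%C)).
    + destruct (Hloc x ltac:(lra)) as [d Hd]. exists d. intros u v Hu _.
      symmetry. apply HD. apply Hd. exact Hu.
    + apply continuity_2d_pt_filterlim.
      apply (continuous_comp (U := prod_UniformSpace R_UniformSpace R_UniformSpace)
               (V := Cmod_top) (W := R_UniformSpace)
               (fun p => C_derive G (cis (fst p) (snd p)) * cis 1 (snd p))%C Re (x, theta));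
        [|apply continuous_Re].
      apply (continuous_mult (K := C_AbsRing) (fun p : R * R => C_derive G (cis (fst p) (snd p)))
               (fun p => cis 1 (snd p))).
      * apply (continuous_comp (U := prod_UniformSpace R_UniformSpace R_UniformSpace)
             (V := Cmod_top) (W := Cmod_top) (fun p : R * R => cis (fst p) (snd p)) (C_derive G)).
        -- apply continuous_cis; [apply continuous_fst | apply continuous_snd].
        -- apply holo_at_continuous_derive, HG. simpl. rewrite Cmod_cis; lra.
      * apply continuous_cis; [apply continuous_const | apply continuous_snd].
  - generalize (Hloc x ltac:(lra)). apply filter_imp. intros u Hu.
    apply circle_ex_RInt; assumption.
Qed.

Lemma two_PI_pos : 0 < 2 * PI.
Proof. generalize PI_RGT_0. lra. Qed.

Lemma circle_mean_ext (F G : C -> C) (t : R) : 0 <= t ->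
  (forall z, Cmod z = t -> Re (F z) = Re (G z)) -> circle_mean F t = circle_mean G t.
Proof.
  intros Ht H. unfold circle_mean. f_equal. apply RInt_ext. intros theta _.
  apply H, Cmod_cis, Ht.
Qed.

Lemma circle_mean_plus (F G : C -> C) (t : R) :
  holo_punctured F -> holo_punctured G -> 0 < t < 1 ->
  circle_mean (fun z => F z + G z)%C t = circle_mean F t + circle_mean G t.
Proof.
  intros HF HG Ht. unfold circle_mean.
  rewrite (RInt_ext (V := R_CompleteNormedModule) _
    (fun theta => plus (Re (F (cis t theta))) (Re (G (cis t theta))))).
  - rewrite (RInt_plus (V := R_CompleteNormedModule)) by (apply circle_ex_RInt; assumption).
    unfold plus; simpl. field. apply PI_neq0.
  - intros theta _. apply re_plus.
Qed.

Lemma circle_mean_scal (c : R) (F : C -> C) (t : R) :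
  holo_punctured F -> 0 < t < 1 ->
  circle_mean (fun z => RtoC c * F z)%C t = c * circle_mean F t.
Proof.
  intros HF Ht. unfold circle_mean.
  rewrite (RInt_ext (V := R_CompleteNormedModule) _ (fun theta => scal c (Re (F (cis t theta))))).
  - rewrite (RInt_scal (V := R_CompleteNormedModule)) by (apply circle_ex_RInt; assumption).
    unfold scal; simpl. unfold mult; simpl. field. apply PI_neq0.
  - intros theta _. apply re_scal_l.
Qed.

Lemma circle_mean_cst (c : C) (t : R) : circle_mean (fun _ => c) t = Re c.
Proof.
  unfold circle_mean. rewrite (RInt_const (V := R_CompleteNormedModule)).
  unfold scal; simpl. unfold mult; simpl. field. apply PI_neq0.
Qed.

Lemma circle_mean_ge_0 (F : C -> C) (t : R) :
  holo_punctured F -> 0 < t < 1 -> (forall z, Cmod z = t -> 0 <= Re (F z)) ->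
  0 <= circle_mean F t.
Proof.
  intros HF Ht H. unfold circle_mean. apply Rmult_le_pos.
  - apply RInt_ge_0; [apply Rlt_le, two_PI_pos | apply circle_ex_RInt; assumption |].
    intros theta _. apply H, Cmod_cis. lra.
  - apply Rlt_le, Rinv_0_lt_compat, two_PI_pos.
Qed.

Lemma circle_mean_bound (F : C -> C) (t M : R) :
  holo_punctured F -> 0 < t < 1 -> (forall z, Cmod z = t -> Cmod (F z) <= M) ->
  Rabs (circle_mean F t) <= M.
Proof.
  intros HF Ht H. unfold circle_mean, Rdiv. rewrite Rabs_mult, (Rabs_pos_eq (/ _)).
  2:{ apply Rlt_le, Rinv_0_lt_compat, two_PI_pos. }
  apply Rmult_le_reg_r with (2 * PI); [apply two_PI_pos|].
  rewrite Rmult_assoc, Rinv_l, Rmult_1_r by (apply Rgt_not_eq, two_PI_pos).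
  replace (M * (2 * PI)) with ((2 * PI - 0) * M) by ring.
  apply abs_RInt_le_const; [apply Rlt_le, two_PI_pos | apply circle_ex_RInt; assumption |].
  intros theta _. eapply Rle_trans; [apply re_le_Cmod|]. apply H, Cmod_cis. lra.
Qed.

(** Let the radius tend to zero in [circle_mean_const]. *)
Lemma circle_mean_bigO (G : C -> C) (t : R) :
  holo_punctured G -> bigO0 G 1 -> 0 < t < 1 -> circle_mean G t = 0.
Proof.
  intros HG [M [d [Hd H]]] Ht.
  apply Rabs_eq_0, Rle_antisym; [|apply Rabs_pos].
  apply le_epsilon. intros eps Heps.
  set (s := Rmin (t / 2) (Rmin (d / 2) (eps / (Rabs M + 1)))).
  assert (HM := Rabs_pos M).
  assert (Hs : 0 < s).
  { unfold s. repeat apply Rmin_pos; try lra. apply Rdiv_lt_0_compat; lra. }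
  assert (Hs1 : s <= t / 2) by apply Rmin_l.
  assert (Hs2 : s <= d / 2) by (eapply Rle_trans; [apply Rmin_r | apply Rmin_l]).
  assert (Hs3 : s <= eps / (Rabs M + 1)) by (eapply Rle_trans; [apply Rmin_r | apply Rmin_r]).
  rewrite <- (circle_mean_const G s t) by (try assumption; lra).
  rewrite Rplus_0_l. apply circle_mean_bound; [exact HG | lra |].
  intros z Hz. eapply Rle_trans; [apply H; lra|]. rewrite Hz.
  apply Rle_trans with ((Rabs M + 1) * s).
  - generalize (Rle_abs M). intros. simpl. nra.
  - apply Rmult_le_compat_l with (r := Rabs M + 1) in Hs3; [|lra].
    replace ((Rabs M + 1) * (eps / (Rabs M + 1))) with eps in Hs3 by (field; lra). exact Hs3.
Qed.

(** * Coefficients of bounded functions *)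

Lemma holo_at_inv_pow (j : nat) (z : C) : z <> 0 -> holo_at (fun w => (/ w) ^ j)%C z.
Proof. intros Hz. apply holo_at_pow, holo_at_inv; [apply holo_at_id | exact Hz]. Qed.

Lemma holo_at_id_pow (j : nat) (z : C) : holo_at (fun w => w ^ j)%C z.
Proof. apply holo_at_pow, holo_at_id. Qed.

Ltac holo_tac :=
  lazymatch goal with
  | |- holo_punctured _ =>
      let z := fresh "z" in let Hz := fresh "Hz" in intros z Hz; holo_tac
  | |- holo_at (fun w => (@?F w + @?G w)%C) _ => apply (holo_at_plus F G); holo_tac
  | |- holo_at (fun w => (@?F w - @?G w)%C) _ => apply (holo_at_minus F G); holo_tac
  | |- holo_at (fun w => (@?F w * @?G w)%C) _ => apply (holo_at_mult F G); holo_tac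
  | |- holo_at (fun w => ((/ w) ^ _)%C) _ =>
      apply holo_at_inv_pow; apply Cmod_gt_0; tauto
  | |- holo_at (fun w => (w ^ _)%C) _ => apply holo_at_id_pow
  | |- holo_at (fun _ => ?c) _ => apply holo_at_const
  | |- _ => auto
  end.

Lemma Cinv_on_circle (z : C) (t : R) :
  0 < t -> Cmod z = t -> (/ z = RtoC (/ (t ^ 2)) * Cconj z)%C.
Proof.
  intros Ht Hz.
  assert (Hnz : z <> 0) by (apply Cmod_gt_0; lra).
  rewrite RtoC_inv by (apply pow_nonzero; lra).
  rewrite <- Hz, Cmod2_conj. field. split; [|exact Hnz].
  intros E. apply (f_equal Cmod) in E. rewrite Cmod_conj, Cmod_0 in E. lra.
Qed.

Lemma Re_inv_pow_on_circle (w z : C) (t : R) (j : nat) :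
  0 < t -> Cmod z = t ->
  Re (w * (/ z) ^ j)%C = Re (Cconj w * RtoC (/ (t ^ 2)) ^ j * z ^ j)%C.
Proof.
  intros Ht Hz. rewrite (Cinv_on_circle z t Ht Hz).
  rewrite <- (re_conj (w * _)%C), Cmult_conj, Cpow_conj, Cmult_conj, Cconj_conj, Cpow_mult_l.
  replace (Cconj (RtoC (/ t ^ 2))) with (RtoC (/ t ^ 2)).
  - f_equal. ring.
  - unfold Cconj, RtoC; simpl. rewrite Ropp_0. reflexivity.
Qed.

Lemma bigO0_monomial (c : C) (j : nat) : (1 <= j)%nat -> bigO0 (fun z => c * z ^ j)%C 1.
Proof.
  intros Hj. exists (Cmod c), 1. split; [lra|]. intros z [Hz1 Hz2].
  rewrite Cmod_mult, Cmod_pow. apply Rmult_le_compat_l; [apply Cmod_ge_0|].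
  destruct j as [|j]; [lia|]. simpl. apply Rmult_le_compat_l; [lra|].
  rewrite <- (pow1 j). apply pow_incr. lra.
Qed.

Lemma circle_mean_monomial (c : C) (j : nat) (t : R) :
  (1 <= j)%nat -> 0 < t < 1 -> circle_mean (fun z => c * z ^ j)%C t = 0.
Proof.
  intros Hj Ht. apply circle_mean_bigO; [holo_tac | apply bigO0_monomial, Hj | exact Ht].
Qed.

(** On a circle around the origin a negative power of [z] is, up to a positive factor, the
    conjugate of the positive power, and conjugation does not change the real part. *)
Lemma circle_mean_inv_monomial (w : C) (j : nat) (t : R) :
  (1 <= j)%nat -> 0 < t < 1 -> circle_mean (fun z => w * (/ z) ^ j)%C t = 0.
Proof.
  intros Hj Ht.
  rewrite (circle_mean_ext _ (fun z => Cconj w * RtoC (/ (t ^ 2)) ^ j * z ^ j)%C); [|lra|].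
  - apply circle_mean_monomial; assumption.
  - intros z Hz. apply Re_inv_pow_on_circle; [lra | exact Hz].
Qed.

Lemma exists_phase (c : C) : exists u : C, Cmod u = 1 /\ (u * c = RtoC (Cmod c))%C.
Proof.
  destruct (Ceq_dec c 0) as [E|E].
  - exists 1. rewrite E, Cmod_0, Cmod_1. split; [reflexivity | ring].
  - assert (Hc : 0 < Cmod c) by (apply Cmod_gt_0; exact E).
    assert (Hn : RtoC (Cmod c) <> 0) by (intros E'; apply RtoC_inj in E'; lra).
    exists (RtoC (Cmod c) / c)%C. split.
    + rewrite Cmod_div, Cmod_R, Rabs_pos_eq by (try exact E; lra). field. lra.
    + field. exact E.
Qed.

Lemma limit_at_one (h : R -> R) :
  continuity_pt h 1 -> (forall t, 0 < t < 1 -> 0 <= h t) -> 0 <= h 1.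
Proof.
  intros Hc H. apply Rnot_lt_le. intros Hneg.
  destruct (Hc (- h 1) ltac:(lra)) as [d [Hd Hh]].
  set (t := Rmax (1 / 2) (1 - d / 2)).
  assert (Ht : 1 / 2 <= t < 1) by (split; [apply Rmax_l | apply Rmax_lub_lt; lra]).
  assert (Ht2 : 1 - d / 2 <= t) by apply Rmax_r.
  assert (Hd' : R_dist (h t) (h 1) < - h 1).
  { apply Hh. split; [split; [exact I | lra]|].
    simpl. unfold R_dist. rewrite Rabs_left; lra. }
  unfold R_dist in Hd'. apply Rabs_def2 in Hd'. specialize (H t ltac:(lra)). lra.
Qed.

Lemma circle_mean_radius (G : C -> C) (s t : R) :
  holo_punctured G -> 0 < s < 1 -> 0 < t < 1 -> circle_mean G s = circle_mean G t.
Proof.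
  intros HG Hs Ht. destruct (Rtotal_order s t) as [H|[H|H]].
  - apply circle_mean_const; try assumption; lra.
  - rewrite H. reflexivity.
  - symmetry. apply circle_mean_const; try assumption; lra.
Qed.

Lemma bigO0_monomial_mult (H : C -> C) (c : C) (m : nat) :
  bigO0 H 0 -> (1 <= m)%nat -> bigO0 (fun z => c * z ^ m * H z)%C 1.
Proof.
  intros [M [d [Hd HM]]] Hm.
  destruct (bigO0_monomial c m Hm) as [M1 [d1 [Hd1 HM1]]].
  exists (M1 * M), (Rmin d d1). split; [apply Rmin_pos; assumption|].
  intros z [Hz1 Hz2].
  specialize (HM z (conj Hz1 (Rlt_le_trans _ _ _ Hz2 (Rmin_l _ _)))).
  specialize (HM1 z (conj Hz1 (Rlt_le_trans _ _ _ Hz2 (Rmin_r _ _)))).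
  rewrite Cmod_mult. simpl in *. 
  replace (M1 * M * (Cmod z * 1)) with ((M1 * (Cmod z * 1)) * (M * 1)) by ring.
  apply Rmult_le_compat; try apply Cmod_ge_0; assumption.
Qed.

(** The zeroth coefficient of [H], read off from circle means alone. *)
Definition mean_value (H : C -> C) : C :=
  (circle_mean H (1 / 2), - circle_mean (fun z => Ci * H z)%C (1 / 2)).

Lemma circle_mean_mult_const (H : C -> C) (w : C) (t : R) :
  holo_punctured H -> 0 < t < 1 ->
  circle_mean (fun z => w * H z)%C t = Re (w * mean_value H)%C.
Proof.
  intros HH Ht. 
  rewrite (circle_mean_radius _ t (1 / 2)) by (try lra; holo_tac).
  destruct w as [x y].
  rewrite (circle_mean_ext _ (fun z => RtoC x * H z + RtoC y * (Ci * H z))%C); [|lra|].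
  - rewrite circle_mean_plus, !circle_mean_scal by (try lra; holo_tac).
    unfold mean_value, Cmult, Re; simpl. ring.
  - intros z _. f_equal. replace (x, y) with (RtoC x + RtoC y * Ci)%C.
    + ring.
    + unfold RtoC, Ci, Cplus, Cmult; simpl. f_equal; ring.
Qed.

(** Caratheodory's weight: on the circle [2 + q + conj q] is nonnegative because [|q| = 1],
    and there [conj q] agrees with a holomorphic monomial.  Hence the mean of
    [(K - u H)(2 + q + conj q)] is nonnegative and only sees the coefficients of [H] of
    index [0] and [m]. *)
Lemma weighted_mean_le (H : C -> C) (u v : C) (K t : R) (m : nat) :
  holo_punctured H -> bigO0 H 0 -> 0 < t < 1 -> (1 <= m)%nat ->
  (forall z, Cmod z = t -> Cmod (H z) <= K) -> Cmod u = 1 -> Cmod v = 1 ->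
  circle_mean (fun z => (u * v * RtoC (t ^ m)) * ((/ z) ^ m * H z))%C t
  <= 2 * (K - Re (u * mean_value H)%C).
Proof.
  intros HH HO Ht Hm HK Hu Hv.
  set (q := fun z => (v * RtoC (t ^ m) * (/ z) ^ m)%C).
  set (q2c := (Cconj (v * RtoC (t ^ m)) * RtoC (/ (t ^ 2)) ^ m)%C).
  assert (HT : 0 <= circle_mean (fun z =>
     RtoC (2 * K) + (RtoC K * q2c * z ^ m + ((RtoC K * v * RtoC (t ^ m)) * (/ z) ^ m
     + (- (RtoC 2 * u) * H z + (- (u * v * RtoC (t ^ m)) * ((/ z) ^ m * H z)
     + - (u * q2c) * z ^ m * H z)))))%C t).
  { apply circle_mean_ge_0; [holo_tac | exact Ht|].
    intros z Hz.
    assert (Hq : Cmod (q z) = 1).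
    { unfold q. rewrite !Cmod_mult, Hv, Cmod_pow, Cmod_R, Cmod_inv, Hz
        by (apply Cmod_gt_0; lra).
      rewrite Rabs_pos_eq by (apply pow_le; lra). rewrite pow_inv. field.
      apply pow_nonzero. lra. }
    assert (Eq2 : (q2c * z ^ m)%C = Cconj (q z)).
    { unfold q, q2c. rewrite (Cinv_on_circle z t) by (try lra; exact Hz).
      rewrite !Cmult_conj, Cpow_conj, Cmult_conj, Cconj_conj, Cpow_mult_l.
      replace (Cconj (RtoC (/ t ^ 2))) with (RtoC (/ t ^ 2)); [ring|].
      unfold Cconj, RtoC; simpl. rewrite Ropp_0. reflexivity. }
    replace (RtoC (2 * K) + (RtoC K * q2c * z ^ m + ((RtoC K * v * RtoC (t ^ m)) * (/ z) ^ m
     + (- (RtoC 2 * u) * H z + (- (u * v * RtoC (t ^ m)) * ((/ z) ^ m * H z)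
     + - (u * q2c) * z ^ m * H z)))))%C
    with ((RtoC 2 + (q z + q2c * z ^ m)) * (RtoC K - u * H z))%C
      by (unfold q; rewrite RtoC_mult; ring).
    rewrite Eq2.
    replace (RtoC 2 + (q z + Cconj (q z)))%C with (RtoC (2 + 2 * Re (q z))).
    2:{ destruct (q z) as [a b]. unfold RtoC, Cconj, Cplus, Re; simpl. f_equal; ring. }
    rewrite re_scal_l. apply Rmult_le_pos.
    - assert (Hr := re_le_Cmod (q z)). rewrite Hq in Hr.
      apply Rabs_le_between in Hr. lra.
    - unfold Cminus. rewrite re_plus, re_opp, re_RtoC.
      assert (Hr := re_le_Cmod (u * H z)%C). rewrite Cmod_mult, Hu in Hr.
      specialize (HK z Hz). apply Rabs_le_between in Hr. lra. }
  rewrite !circle_mean_plus in HT by (try exact Ht; holo_tac).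
  rewrite circle_mean_cst, circle_mean_monomial, circle_mean_inv_monomial in HT by assumption.
  rewrite (circle_mean_mult_const H) in HT by assumption.
  rewrite (circle_mean_bigO (fun z => - (u * q2c) * z ^ m * H z)%C) in HT
    by first [exact Ht | apply bigO0_monomial_mult; assumption | holo_tac].
  rewrite re_RtoC in HT.
  replace (circle_mean (fun z => - (u * v * RtoC (t ^ m)) * ((/ z) ^ m * H z))%C t) with
    (- circle_mean (fun z => (u * v * RtoC (t ^ m)) * ((/ z) ^ m * H z))%C t) in HT.
  2:{ replace (- circle_mean (fun z => (u * v * RtoC (t ^ m)) * ((/ z) ^ m * H z))%C t) with
       (-1 * circle_mean (fun z => (u * v * RtoC (t ^ m)) * ((/ z) ^ m * H z))%C t) by ring.
      rewrite <- circle_mean_scal by (try exact Ht; holo_tac).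
      apply circle_mean_ext; [lra|]. intros z _. f_equal.
      replace (RtoC (-1)) with (- RtoC 1)%C by (rewrite <- RtoC_opp; f_equal; lra). ring. }
  replace (Re (- (RtoC 2 * u) * mean_value H)%C) with (- 2 * Re (u * mean_value H)%C) in HT.
  2:{ rewrite <- re_scal_l. f_equal.
      replace (RtoC (- 2)) with (- RtoC 2)%C by (rewrite <- RtoC_opp; f_equal; lra). ring. }
  lra.
Qed.

(** The inequality [|h_m| <= 2 (1 - |h_0|)] for the coefficients of a function bounded by
    one.  The coefficients enter through circle means only, so that no expansion of [H] in
    the disc has to be constructed, and [tau] is the modulus of the zeroth one.  The bound
    on [H] need not be one inside the disc, since the radius tends to one in the proof. *)
Lemma bounded_coefficients (H : C -> C) (k : nat) :
  holo_punctured H -> bigO0 H 0 ->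
  (forall z, 0 < Cmod z < 1 -> Cmod (H z) <= (/ Cmod z) ^ k) ->
  exists tau : R, 0 <= tau <= 1 /\
    forall (w : C) (t : R), 0 < t < 1 ->
      circle_mean (fun z => w * H z)%C t <= Cmod w * tau /\
      forall m, (1 <= m)%nat ->
        circle_mean (fun z => w * ((/ z) ^ m * H z))%C t <= Cmod w * (2 * (1 - tau)).
Proof.
  intros HH HO HK. exists (Cmod (mean_value H)).
  destruct (exists_phase (mean_value H)) as [u [Hu Eu]].
  assert (Eur : Re (u * mean_value H)%C = Cmod (mean_value H)) by (rewrite Eu; apply re_RtoC).
  set (tau := Cmod (mean_value H)) in *.
  assert (Hk : forall t, 0 < t < 1 -> 0 < t ^ k) by (intros t Ht; apply pow_lt; lra).
  split; [split; [apply Cmod_ge_0|]|].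
  - assert (Hlim : 0 <= 1 - 1 ^ k * tau).
    { apply (limit_at_one (fun t => 1 - t ^ k * tau)); [reg|].
      intros t Ht. specialize (Hk t Ht).
      assert (Hb : Rabs (circle_mean (fun z => u * H z)%C t) <= (/ t) ^ k).
      { apply circle_mean_bound; [holo_tac | exact Ht|]. intros z Hz.
        rewrite Cmod_mult, Hu, Rmult_1_l. rewrite <- Hz. apply HK. lra. }
      rewrite circle_mean_mult_const, Eur in Hb by assumption.
      apply Rabs_le_between in Hb. rewrite pow_inv in Hb.
      assert (t ^ k * tau <= t ^ k * / t ^ k) by (apply Rmult_le_compat_l; lra).
      rewrite Rinv_r in H0; lra. }
    rewrite pow1 in Hlim. lra.
  - intros w t Ht. split.
    + rewrite circle_mean_mult_const by assumption.
      eapply Rle_trans; [apply Rle_abs|]. eapply Rle_trans; [apply re_le_Cmod|].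
      rewrite Cmod_mult. apply Rle_refl.
    + intros m Hm.
      set (X := circle_mean (fun z => w * ((/ z) ^ m * H z))%C t).
      (* [w = |w| u v] with [v] unimodular, so that the phase [u] is free to be the one above *)
      assert (Hw : exists v, Cmod v = 1 /\ w = (RtoC (Cmod w) * (u * v))%C).
      { destruct (exists_phase w) as [x [Hx Ex]].
        assert (Hx0 : x <> 0) by (apply Cmod_gt_0; lra).
        assert (Hu0 : u <> 0) by (apply Cmod_gt_0; lra).
        exists (/ (x * u))%C. split.
        - rewrite Cmod_inv, Cmod_mult, Hx, Hu by (apply Cmult_neq_0; assumption). field.
        - rewrite <- Ex. field. split; assumption. }
      destruct Hw as [v [Hv Ew]].
      assert (Hlim : 0 <= Cmod w * (2 * (1 - tau * 1 ^ k)) - X * 1 ^ m * 1 ^ k).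
      { apply (limit_at_one (fun s => Cmod w * (2 * (1 - tau * s ^ k)) - X * s ^ m * s ^ k)); [reg|].
        intros s Hs.
        assert (HKs : forall z, Cmod z = s -> Cmod (H z) <= (/ s) ^ k)
          by (intros z Hz; rewrite <- Hz; apply HK; lra).
        assert (Hle := weighted_mean_le H u v ((/ s) ^ k) s m HH HO Hs Hm HKs Hu Hv).
        rewrite Eur in Hle.
        assert (EX : X * s ^ m = Cmod w * circle_mean (fun z => (u * v * RtoC (s ^ m)) * ((/ z) ^ m * H z))%C s).
        { unfold X. rewrite (circle_mean_radius _ t s) by (try assumption; holo_tac).
          rewrite Rmult_comm, <- !circle_mean_scal by (try assumption; holo_tac).
          apply circle_mean_ext; [lra|]. intros z _. f_equal. rewrite Ew at 1. ring. }
        rewrite EX. specialize (Hk s Hs).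
        assert (Hle2 : circle_mean (fun z => (u * v * RtoC (s ^ m)) * ((/ z) ^ m * H z))%C s * s ^ k
                  <= 2 * (1 - tau * s ^ k)).
        { apply Rmult_le_compat_r with (r := s ^ k) in Hle; [|lra].
          replace (2 * ((/ s) ^ k - tau) * s ^ k) with (2 * (1 - tau * s ^ k)) in Hle; [exact Hle|].
          rewrite pow_inv. field. lra. }
        apply Rmult_le_compat_l with (r := Cmod w) in Hle2; [|apply Cmod_ge_0]. lra. }
      rewrite !pow1 in Hlim. lra.
Qed.

(** * Odd series and comparison of coefficients *)

Lemma sum_n_odd (G : AbelianMonoid) (u : nat -> G) (J : nat) :
  (forall j, u (2 * j)%nat = zero) ->
  sum_n u (2 * J + 1) = sum_n (fun j => u (2 * j + 1)%nat) J /\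
  sum_n u (2 * J + 2) = sum_n (fun j => u (2 * j + 1)%nat) J.
Proof.
  intros H0.
  assert (Hs : forall I, sum_n u (2 * I + 1) = sum_n (fun j => u (2 * j + 1)%nat) I ->
                    sum_n u (2 * I + 2) = sum_n (fun j => u (2 * j + 1)%nat) I).
  { intros I E. replace (2 * I + 2)%nat with (S (2 * I + 1)) by lia.
    rewrite sum_Sn, E. replace (S (2 * I + 1)) with (2 * (I + 1))%nat by lia.
    rewrite H0. apply plus_zero_r. }
  assert (E : sum_n u (2 * J + 1) = sum_n (fun j => u (2 * j + 1)%nat) J).
  { induction J as [|J IH].
    - change (2 * 0 + 1)%nat with 1%nat. rewrite sum_Sn, !sum_O.
      rewrite (H0 0%nat : u 0%nat = zero). apply plus_zero_l.
    - apply Hs in IH. replace (2 * S J + 1)%nat with (S (2 * J + 2)) by lia.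
      rewrite sum_Sn, IH, sum_Sn. f_equal. f_equal. lia. }
  split; [exact E | apply Hs, E].
Qed.

Lemma sum_n_even (G : AbelianMonoid) (u : nat -> G) (J : nat) :
  (forall j, u (2 * j + 1)%nat = zero) ->
  sum_n u (2 * J) = sum_n (fun j => u (2 * j)%nat) J.
Proof.
  intros H0. induction J as [|J IH].
  - simpl. rewrite !sum_O. reflexivity.
  - replace (2 * S J)%nat with (S (S (2 * J))) by lia.
    rewrite !sum_Sn, IH. replace (S (2 * J)) with (2 * J + 1)%nat by lia.
    rewrite H0, plus_zero_r. f_equal. f_equal. lia.
Qed.

Lemma is_series_of_odd (K : AbsRing) (V : NormedModule K) (u : nat -> V) (l : V) :
  (forall j, u (2 * j)%nat = zero) ->
  is_series (fun j => u (2 * j + 1)%nat) l -> is_series u l.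
Proof.
  intros H0 H P HP. destruct (H P HP) as [N HN].
  exists (2 * N + 1)%nat. intros m Hm.
  destruct (Nat.Even_or_Odd (m - 1)) as [[J E]|[J E]].
  - replace m with (2 * J + 1)%nat by lia.
    rewrite (proj1 (sum_n_odd _ u J H0)). apply HN. lia.
  - replace m with (2 * J + 2)%nat by lia.
    rewrite (proj2 (sum_n_odd _ u J H0)). apply HN. lia.
Qed.

Lemma is_series_even (K : AbsRing) (V : NormedModule K) (u : nat -> V) (l : V) :
  (forall j, u (2 * j + 1)%nat = zero) ->
  is_series u l -> is_series (fun j => u (2 * j)%nat) l.
Proof.
  intros H0 H P HP. destruct (H P HP) as [N HN].
  exists N. intros J HJ. rewrite <- (sum_n_even _ u J H0). apply HN. lia.
Qed.

Definition odd_part (a : nat -> C) (n : nat) : C := if Nat.odd n then a n else 0.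

Lemma odd_part_even (a : nat -> C) (j : nat) : odd_part a (2 * j)%nat = 0.
Proof. unfold odd_part. rewrite Nat.odd_mul. reflexivity. Qed.

Lemma odd_part_odd (a : nat -> C) (j : nat) : odd_part a (2 * j + 1)%nat = a (2 * j + 1)%nat.
Proof. unfold odd_part. rewrite Nat.odd_add, Nat.odd_mul. reflexivity. Qed.

Lemma odd_analytic_expansion (f : C -> C) (a : nat -> C) :
  odd_analytic f a -> expansion_in_disk f (odd_part a).
Proof.
  intros [_ H] z Hz. apply is_Cpseries_series.
  apply (is_series_of_odd C_AbsRing C_NormedModule).
  - intros j. rewrite odd_part_even. apply Cmult_0_l.
  - eapply is_series_ext; [|exact (H z Hz)]. intros j. rewrite odd_part_odd. reflexivity.
Qed.

Lemma odd_analytic_majorant (f : C -> C) (a : nat -> C) (r : R) :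
  odd_analytic f a -> 0 <= r < 1 ->
  is_series (fun j => INR (2 * j + 1) * (r ^ 2) ^ j * Cmod (a (2 * j + 1)%nat))
    (majorant_series (C_derive f) r).
Proof.
  intros H Hr. apply odd_analytic_expansion in H.
  assert (HM := majorant_series_derive _ _ _ H Hr).
  apply (is_series_even R_AbsRing R_NormedModule) in HM.
  - eapply is_series_ext; [|exact HM]. intros j. cbv beta.
    replace (S (2 * j)) with (2 * j + 1)%nat by lia. rewrite odd_part_odd.
    match goal with |- ?x = ?y => change (@eq R x y) end.
    rewrite pow_mult. ring.
  - intros j. replace (S (2 * j + 1)) with (2 * (j + 1))%nat by lia.
    rewrite odd_part_even, Cmod_0. match goal with |- ?x = _ => change (@eq R x 0) end. ring.
Qed.

Lemma odd_analytic_remainder (f : C -> C) (a : nat -> C) (J : nat) :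
  odd_analytic f a ->
  exists M d : R, 0 <= M /\ 0 < d /\ forall z : C, Cmod z < d ->
    Cmod (f z - Csum (fun j => a (2 * j + 1)%nat * z ^ (2 * j + 1)) J)%C
    <= M * Cmod z ^ (2 * J + 2).
Proof.
  intros H. apply odd_analytic_expansion, expansion_in_disk_has_expansion in H.
  destruct (has_expansion_remainder _ _ _ (2 * J + 1) Rlt_0_1 H) as [M [d [HM [Hd Hz]]]].
  exists M, d. split; [exact HM|]. split; [exact Hd|]. intros z Hzd. specialize (Hz z Hzd).
  rewrite (proj1 (sum_n_odd C_AbelianMonoid _ J
     (fun j => eq_trans (f_equal (fun c => (c * z ^ (2 * j))%C) (odd_part_even a j)) (Cmult_0_l _)))) in Hz.
  replace (S (2 * J + 1)) with (2 * J + 2)%nat in Hz by lia.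
  rewrite (sum_n_ext _ (fun j => a (2 * j + 1)%nat * z ^ (2 * j + 1))%C) in Hz; [exact Hz|].
  intros j. rewrite odd_part_odd. reflexivity.
Qed.

Lemma holo_at_sum (F : nat -> C -> C) (n : nat) (z : C) :
  (forall k, holo_at (F k) z) -> holo_at (fun w => Csum (fun k => F k w) n) z.
Proof.
  intros H. induction n as [|n IH].
  - apply (holo_at_ext (F 0%nat)); [intros w; rewrite sum_O; reflexivity | apply H].
  - apply (holo_at_ext (fun w => Csum (fun k => F k w) n + F (S n) w)%C).
    + intros w. rewrite sum_Sn. reflexivity.
    + apply (holo_at_plus _ _ _ IH (H (S n))).
Qed.

Lemma circle_mean_sum (F : nat -> C -> C) (n : nat) (t : R) :
  (forall k, holo_punctured (F k)) -> 0 < t < 1 ->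
  circle_mean (fun z => Csum (fun k => F k z) n) t = sum_n (fun k => circle_mean (F k) t) n.
Proof.
  intros H Ht. induction n as [|n IH].
  - rewrite sum_O. apply circle_mean_ext; [lra|]. intros z _. rewrite sum_O. reflexivity.
  - rewrite sum_Sn, <- IH. unfold plus; simpl.
    rewrite <- circle_mean_plus.
    + apply circle_mean_ext; [lra|]. intros z _. rewrite sum_Sn. reflexivity.
    + intros z Hz. apply (holo_at_sum F). intros k. apply H, Hz.
    + apply H.
    + exact Ht.
Qed.

Lemma Csum_mult (c : C) (u : nat -> C) (n : nat) :
  (c * Csum u n = Csum (fun k => c * u k) n)%C.
Proof.
  induction n as [|n IH]; [rewrite !sum_O; reflexivity|].
  rewrite !sum_Sn, <- IH. unfold plus; simpl. ring.
Qed.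

Lemma Csum_minus (u v : nat -> C) (n : nat) :
  (Csum u n - Csum v n = Csum (fun k => u k - v k) n)%C.
Proof.
  induction n as [|n IH]; [rewrite !sum_O; reflexivity|].
  rewrite !sum_Sn, <- IH. unfold plus; simpl. ring.
Qed.

(** The series with coefficients [b] is the sum of the terms [a_(2j+1) z^(2j+1)] multiplied
    by functions [H_j] that are bounded by nearly one near the unit circle.  Dividing by
    [z^(2J+1)] and taking circle means isolates [b_(2J+1)] on one side and one coefficient
    of each [H_j] on the other, to which [bounded_coefficients] applies.  The difference of
    the two sides has mean zero because it is small at the origin. *)
Lemma coefficient_comparison (a b : nat -> C) (H : nat -> C -> C) :
  (forall j, holo_punctured (H j)) -> (forall j, bigO0 (H j) 0) ->
  (forall j z, 0 < Cmod z < 1 -> Cmod (H j z) <= (/ Cmod z) ^ (2 * j + 1)) ->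
  (forall J, bigO0 (fun z => Csum (fun j => b (2 * j + 1)%nat * z ^ (2 * j + 1)) J
                - Csum (fun j => a (2 * j + 1)%nat * z ^ (2 * j + 1) * H j z) J)%C (2 * J + 2)) ->
  exists tau : nat -> R, (forall j, 0 <= tau j <= 1) /\
    forall J, Cmod (b (2 * J + 1)%nat) <=
      sum_n (fun j => Cmod (a (2 * j + 1)%nat) *
                 (if (j =? J)%nat then tau j else 2 * (1 - tau j))) J.
Proof.
  intros HH HO HK HD.
  destruct (choice (fun j tau => 0 <= tau <= 1 /\
    forall (w : C) (t : R), 0 < t < 1 ->
      circle_mean (fun z => w * H j z)%C t <= Cmod w * tau /\
      forall m, (1 <= m)%nat ->
        circle_mean (fun z => w * ((/ z) ^ m * H j z))%C t <= Cmod w * (2 * (1 - tau))))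
    as [tau Htau].
  { intros j. apply (bounded_coefficients (H j) (2 * j + 1)); auto. }
  exists tau. split; [intros j; apply Htau|]. intros J.
  set (t := 1 / 2). assert (Ht : 0 < t < 1) by (unfold t; lra).
  destruct (exists_phase (b (2 * J + 1)%nat)) as [u [Hu Eu]].
  set (P := fun (j : nat) z => (u * b (2 * j + 1)%nat * (/ z) ^ (2 * (J - j)))%C).
  set (Q := fun (j : nat) z => (u * a (2 * j + 1)%nat * ((/ z) ^ (2 * (J - j)) * H j z))%C).
  assert (hP : forall j, holo_punctured (P j)) by (intros j; unfold P; holo_tac).
  assert (hQ : forall j, holo_punctured (Q j)).
  { intros j. assert (Hj := HH j). unfold Q. holo_tac. }
  assert (hPQ : forall j, holo_punctured (fun z => P j z - Q j z)%C).
  { intros j z Hz. apply holo_at_minus; [apply hP | apply hQ]; exact Hz. }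
  assert (Hpw : forall z : C, z <> 0 -> forall j, (j <= J)%nat ->
      ((/ z) ^ (2 * J + 1) * z ^ (2 * j + 1) = (/ z) ^ (2 * (J - j)))%C).
  { intros z Hz j Hj. replace (2 * J + 1)%nat with (2 * (J - j) + (2 * j + 1))%nat by lia.
    rewrite Cpow_add_r, <- Cmult_assoc, <- Cpow_mult_l, Cinv_l, Cpow_1_l by exact Hz. ring. }
  assert (Esum : forall z : C, z <> 0 ->
    Csum (fun j => P j z - Q j z)%C J = (u * (/ z) ^ (2 * J + 1) *
       (Csum (fun j => b (2 * j + 1)%nat * z ^ (2 * j + 1)) J
        - Csum (fun j => a (2 * j + 1)%nat * z ^ (2 * j + 1) * H j z) J))%C).
  { intros z Hz. rewrite Csum_minus, Csum_mult.
    apply (sum_n_ext_loc (G := C_AbelianMonoid)). intros j Hj. unfold P, Q.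
    rewrite <- (Hpw z Hz j Hj). match goal with |- ?x = ?y => change (@eq C x y) end. ring. }
  assert (Hzero : sum_n (fun j => circle_mean (fun z => P j z - Q j z)%C t) J = 0).
  { rewrite <- circle_mean_sum by assumption. apply circle_mean_bigO; [| |exact Ht].
    - intros z Hz. apply (holo_at_sum (fun j z => P j z - Q j z)%C). intros j. apply hPQ, Hz.
    - destruct (HD J) as [M [d [Hd HM]]]. exists M, d. split; [exact Hd|].
      intros z Hz. assert (Hnz : z <> 0) by (apply Cmod_gt_0; lra).
      rewrite Esum by exact Hnz. rewrite !Cmod_mult, Hu, Cmod_pow, Cmod_inv, Rmult_1_l by exact Hnz.
      specialize (HM z Hz).
      apply Rle_trans with ((/ Cmod z) ^ (2 * J + 1) * (M * Cmod z ^ (2 * J + 2))).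
      + apply Rmult_le_compat_l; [apply pow_le, Rlt_le, Rinv_0_lt_compat; lra | exact HM].
      + right. replace (2 * J + 2)%nat with (S (2 * J + 1)) by lia.
        rewrite pow_inv, <- tech_pow_Rmult, pow_1. field. apply pow_nonzero. lra. }
  assert (EP : forall j, (j <= J)%nat ->
     circle_mean (P j) t = if (j =? J)%nat then Cmod (b (2 * J + 1)%nat) else 0).
  { intros j Hj. destruct (Nat.eqb_spec j J) as [E|E].
    - subst j. unfold P. rewrite (circle_mean_ext _ (fun _ => RtoC (Cmod (b (2 * J + 1)%nat)))).
      + rewrite circle_mean_cst. apply re_RtoC.
      + lra.
      + intros z _. rewrite Eu, Nat.sub_diag. change ((/ z) ^ (2 * 0))%C with (RtoC 1). f_equal. ring.
    - apply circle_mean_inv_monomial; [lia | exact Ht]. }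
  assert (EQ : forall j, (j <= J)%nat -> circle_mean (Q j) t <=
     Cmod (a (2 * j + 1)%nat) * (if (j =? J)%nat then tau j else 2 * (1 - tau j))).
  { intros j Hj. destruct (Htau j) as [_ Hj'].
    destruct (Hj' (u * a (2 * j + 1)%nat)%C t Ht) as [H1 H2].
    replace (Cmod (a (2 * j + 1)%nat)) with (Cmod (u * a (2 * j + 1)%nat)%C)
      by (rewrite Cmod_mult, Hu; ring).
    destruct (Nat.eqb_spec j J) as [E|E].
    - subst j. unfold Q. rewrite Nat.sub_diag.
      rewrite (circle_mean_ext _ (fun z => u * a (2 * J + 1)%nat * H J z)%C); [exact H1 | lra |].
      intros z _. change ((/ z) ^ (2 * 0))%C with (RtoC 1). f_equal. ring.
    - apply H2. lia. }
  assert (Esub : forall n, (n <= J)%nat -> 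
     sum_n (fun j => circle_mean (fun z => P j z - Q j z)%C t) n >=
     sum_n (fun j => if (j =? J)%nat then Cmod (b (2 * J + 1)%nat) else 0) n
     - sum_n (fun j => Cmod (a (2 * j + 1)%nat) * (if (j =? J)%nat then tau j else 2 * (1 - tau j))) n).
  { assert (Hterm : forall j, (j <= J)%nat -> circle_mean (fun z => P j z - Q j z)%C t >=
      (if (j =? J)%nat then Cmod (b (2 * J + 1)%nat) else 0)
      - Cmod (a (2 * j + 1)%nat) * (if (j =? J)%nat then tau j else 2 * (1 - tau j))).
    { intros j Hj. specialize (EP j Hj). specialize (EQ j Hj).
      assert (E : circle_mean (P j) t = circle_mean (fun z => P j z - Q j z)%C t + circle_mean (Q j) t).
      { rewrite <- circle_mean_plus by (try exact Ht; auto).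
        apply circle_mean_ext; [lra|]. intros z _. f_equal. ring. }
      rewrite EP in E. lra. }
    induction n as [|n IH]; intros Hn.
    - rewrite !sum_O. apply Hterm. lia.
    - rewrite !sum_Sn. unfold plus; simpl. specialize (IH ltac:(lia)).
      specialize (Hterm (S n) Hn). simpl in *. lra. }
  specialize (Esub J (Nat.le_refl J)). rewrite Hzero in Esub.
  assert (Elast : sum_n (fun j => if (j =? J)%nat then Cmod (b (2 * J + 1)%nat) else 0) J
                  = Cmod (b (2 * J + 1)%nat)).
  { destruct J as [|J']; [rewrite sum_O; reflexivity|].
    rewrite sum_Sn, Nat.eqb_refl.
    rewrite (sum_n_ext_loc _ (fun _ => 0)).
    - rewrite sum_n_const. unfold plus; simpl. ring.
    - intros j Hj. destruct (Nat.eqb_spec j (S J')); [lia | reflexivity]. }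
  rewrite Elast in Esub. lra.
Qed.

(** The closed form of the tail [sum_(J > K) (2J+1) x^J]. *)
Definition odd_tail (x : R) (K : nat) : R :=
  x ^ S K * ((2 * INR K + 3) - (2 * INR K + 1) * x) / (1 - x) ^ 2.

Lemma odd_tail_step (x : R) (K : nat) : x <> 1 ->
  odd_tail x K = (2 * INR (S K) + 1) * x ^ S K + odd_tail x (S K).
Proof.
  intros Hx. unfold odd_tail. rewrite S_INR.
  rewrite <- (tech_pow_Rmult x (S K)). field. lra.
Qed.

(** The critical radius enters here: [(4 - sqrt 13) / 3] is the smaller root of
    [3 x^2 - 8 x + 1], and for [K = 0] the two inequalities are equivalent. *)
Lemma odd_tail_le (x : R) (K : nat) : 0 <= x < 1 -> 0 <= 3 * x ^ 2 - 8 * x + 1 ->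
  2 * odd_tail x K <= (2 * INR K + 1) * x ^ K.
Proof.
  intros Hx Hq. unfold odd_tail. assert (HK := pos_INR K).
  assert (Hp : 0 <= x ^ K) by (apply pow_le; lra).
  assert (H1 : 0 < (1 - x) ^ 2) by (apply pow_lt; lra).
  apply Rmult_le_reg_r with ((1 - x) ^ 2); [exact H1|].
  replace (2 * (x ^ S K * (2 * INR K + 3 - (2 * INR K + 1) * x) / (1 - x) ^ 2) * (1 - x) ^ 2)
    with (x ^ K * (2 * x * (2 * INR K + 3 - (2 * INR K + 1) * x))) by (simpl; field; lra).
  replace ((2 * INR K + 1) * x ^ K * (1 - x) ^ 2) with (x ^ K * ((2 * INR K + 1) * (1 - x) ^ 2)) by ring.
  apply Rmult_le_compat_l; [exact Hp|]. nra.
Qed.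

(** The tail attached to the mass [2 (1 - tau_j) alpha_j] produced by the [j]-th term does
    not depend on [j], so a single quantity carries the induction. *)
Lemma weighted_odd_sums_le (alpha beta tau : nat -> R) (x : R) (K : nat) :
  0 <= x < 1 -> 0 <= 3 * x ^ 2 - 8 * x + 1 ->
  (forall j, 0 <= alpha j) -> (forall j, 0 <= tau j <= 1) ->
  (forall J, beta J <= sum_n (fun j => alpha j * (if (j =? J)%nat then tau j else 2 * (1 - tau j))) J) ->
  sum_n (fun j => INR (2 * j + 1) * x ^ j * beta j) K
  <= sum_n (fun j => INR (2 * j + 1) * x ^ j * alpha j) K.
Proof.
  intros Hx Hq Ha Ht Hb.
  set (m := fun j => alpha j * (2 * (1 - tau j))).
  assert (Hm : forall j, 0 <= m j).
  { intros j. specialize (Ha j). specialize (Ht j). unfold m. apply Rmult_le_pos; lra. }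
  assert (Hoff : forall n J, (n < J)%nat ->
    sum_n (fun j => alpha j * (if (j =? J)%nat then tau j else 2 * (1 - tau j))) n = sum_n m n).
  { intros n J Hn. apply sum_n_ext_loc. intros j Hj.
    destruct (Nat.eqb_spec j J); [lia | reflexivity]. }
  assert (Hodd : forall j, INR (2 * j + 1) = 2 * INR j + 1).
  { intros j. rewrite plus_INR, mult_INR. simpl. ring. }
  assert (Hmain : forall j, (2 * INR j + 1) * x ^ j * (alpha j * tau j) + m j * odd_tail x j
       <= (2 * INR j + 1) * x ^ j * alpha j).
  { intros j. assert (HT := odd_tail_le x j Hx Hq). specialize (Ha j). specialize (Ht j).
    replace (m j * odd_tail x j) with (alpha j * (1 - tau j) * (2 * odd_tail x j)) by (unfold m; ring).
    assert (alpha j * (1 - tau j) * (2 * odd_tail x j)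
            <= alpha j * (1 - tau j) * ((2 * INR j + 1) * x ^ j)).
    { apply Rmult_le_compat_l; [apply Rmult_le_pos; lra | exact HT]. }
    lra. }
  assert (Hind : sum_n (fun j => INR (2 * j + 1) * x ^ j * beta j) K + sum_n m K * odd_tail x K
    <= sum_n (fun j => INR (2 * j + 1) * x ^ j * alpha j) K).
  { induction K as [|K IH].
    - rewrite !sum_O, Hodd. specialize (Hb 0%nat). rewrite sum_O in Hb. simpl (0 =? 0)%nat in Hb.
      cbv iota in Hb. specialize (Hmain 0%nat).
      assert (0 <= (2 * INR 0 + 1) * x ^ 0) by (simpl; lra).
      apply Rmult_le_compat_l with (r := (2 * INR 0 + 1) * x ^ 0) in Hb; [|assumption]. lra.
    - rewrite !sum_Sn.
      specialize (Hb (S K)). rewrite sum_Sn, Hoff in Hb by lia. rewrite Nat.eqb_refl in Hb.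
      change (beta (S K) <= sum_n m K + alpha (S K) * tau (S K)) in Hb.
      specialize (Hmain (S K)). rewrite (odd_tail_step x K) in IH by lra.
      assert (Hc : 0 <= (2 * INR (S K) + 1) * x ^ S K).
      { apply Rmult_le_pos; [generalize (pos_INR (S K)); lra | apply pow_le; lra]. }
      apply Rmult_le_compat_l with (r := (2 * INR (S K) + 1) * x ^ S K) in Hb; [|exact Hc].
      change (sum_n (fun j => INR (2 * j + 1) * x ^ j * beta j) K
        + INR (2 * S K + 1) * x ^ S K * beta (S K) + (sum_n m K + m (S K)) * odd_tail x (S K)
        <= sum_n (fun j => INR (2 * j + 1) * x ^ j * alpha j) K
         + INR (2 * S K + 1) * x ^ S K * alpha (S K)).
      rewrite Hodd.
      lra. }
  assert (Hpos : 0 <= sum_n m K * odd_tail x K).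
  { apply Rmult_le_pos.
    - apply Rle_trans with (sum_n (fun _ => 0) K); [rewrite sum_n_const; lra | apply sum_n_m_le, Hm].
    - unfold odd_tail. apply Rmult_le_pos.
      + apply Rmult_le_pos; [apply pow_le; lra | generalize (pos_INR K); nra].
      + apply Rlt_le, Rinv_0_lt_compat, pow_lt. lra. }
  lra.
Qed.

(** * The two comparison inequalities *)

Lemma r0_tilde_sq_bound (r : R) : 0 <= r <= r0_tilde ->
  r < 1 /\ 0 <= 3 * (r ^ 2) ^ 2 - 8 * r ^ 2 + 1.
Proof.
  intros [H0 H1]. unfold r0_tilde in H1.
  assert (Hs : sqrt 13 * sqrt 13 = 13) by (apply sqrt_sqrt; lra).
  assert (Hp : 0 <= sqrt 13) by apply sqrt_pos.
  assert (Hx0 : 0 <= (4 - sqrt 13) / 3) by nra.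
  assert (Hx : r * r <= (4 - sqrt 13) / 3).
  { rewrite <- (sqrt_sqrt _ Hx0). apply Rmult_le_compat; assumption. }
  split; [nra|].
  assert (H2 : sqrt 13 * sqrt 13 <= (4 - 3 * (r * r)) * (4 - 3 * (r * r)))
    by (apply Rmult_le_compat; lra).
  replace (3 * (r ^ 2) ^ 2 - 8 * r ^ 2 + 1) with (3 * (r * r) * (r * r) - 8 * (r * r) + 1) by ring.
  nra.
Qed.

(** What subordination and domination have in common: up to any order at the origin, [g] is
    a superposition of the terms of [f] multiplied by functions [H_j] bounded by nearly one
    near the unit circle. *)
Lemma majorant_comparison (f g : C -> C) (a b : nat -> C) (H : nat -> C -> C) (r : R) :
  odd_analytic f a -> odd_analytic g b -> 0 <= r <= r0_tilde ->
  (forall j, holo_punctured (H j)) -> (forall j, bigO0 (H j) 0) ->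
  (forall j z, 0 < Cmod z < 1 -> Cmod (H j z) <= (/ Cmod z) ^ (2 * j + 1)) ->
  (forall J, bigO0 (fun z => g z
                - Csum (fun j => a (2 * j + 1)%nat * z ^ (2 * j + 1) * H j z) J)%C (2 * J + 2)) ->
  majorant_series (C_derive g) r <= majorant_series (C_derive f) r.
Proof.
  intros Hf Hg Hr HH HO HK HD.
  destruct (r0_tilde_sq_bound r Hr) as [Hr1 Hq].
  destruct (coefficient_comparison a b H HH HO HK) as [tau [Ht Hb]].
  { intros J. destruct (HD J) as [M1 [d1 [Hd1 H1]]].
    destruct (odd_analytic_remainder g b J Hg) as [M2 [d2 [HM2 [Hd2 H2]]]].
    exists (M2 + M1), (Rmin d1 d2). split; [apply Rmin_pos; assumption|].
    intros z [Hz0 Hz].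
    specialize (H1 z (conj Hz0 (Rlt_le_trans _ _ _ Hz (Rmin_l _ _)))).
    specialize (H2 z (Rlt_le_trans _ _ _ Hz (Rmin_r _ _))).
    match goal with |- Cmod (?X - ?Y)%C <= _ =>
      replace (X - Y)%C with (- (g z - X) + (g z - Y))%C by ring end.
    eapply Rle_trans; [apply Cmod_triangle|]. rewrite Cmod_opp, Rmult_plus_distr_r. lra. }
  assert (Hfs := odd_analytic_majorant f a r Hf (conj (proj1 Hr) Hr1)).
  assert (Hgs := odd_analytic_majorant g b r Hg (conj (proj1 Hr) Hr1)).
  refine (is_lim_seq_le _ _ (majorant_series (C_derive g) r) (majorant_series (C_derive f) r) _ Hgs Hfs).
  intros K.
  apply (weighted_odd_sums_le (fun j => Cmod (a (2 * j + 1)%nat))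
           (fun j => Cmod (b (2 * j + 1)%nat)) tau).
  - split; [apply pow2_ge_0|]. destruct Hr as [Hr0 _]. simpl. nra.
  - exact Hq.
  - intros j. apply Cmod_ge_0.
  - exact Ht.
  - exact Hb.
Qed.

Lemma analytic_has_expansion (F : C -> C) (z0 : C) :
  analytic_in_disk F -> in_disk z0 ->
  exists (rho : R) (A : nat -> C), 0 < rho /\ has_expansion F z0 rho A.
Proof. intros H Hz. exact (H z0 Hz). Qed.

Lemma analytic_holo (F : C -> C) (z : C) : analytic_in_disk F -> in_disk z -> holo_at F z.
Proof.
  intros H Hz. destruct (analytic_has_expansion F z H Hz) as [rho [A [Hrho HA]]].
  exact (has_expansion_holo F z rho A z HA (center_in_ball z rho Hrho)).
Qed.

Lemma in_disk_0 : in_disk 0.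
Proof. unfold in_disk. rewrite Cmod_0. lra. Qed.

Lemma analytic_vanishing_at_0 (phi : C -> C) :
  analytic_in_disk phi -> phi 0 = 0 ->
  exists M d : R, 0 <= M /\ 0 < d /\ forall z : C, Cmod z < d -> Cmod (phi z) <= M * Cmod z.
Proof.
  intros H H0. destruct (analytic_has_expansion phi 0 H in_disk_0) as [rho [A [Hrho HA]]].
  assert (A0 := has_expansion_center _ _ _ _ Hrho HA). rewrite H0 in A0.
  destruct (has_expansion_remainder _ _ _ 0 Hrho HA) as [M [d [HM [Hd Hz]]]].
  exists M, d. split; [exact HM|]. split; [exact Hd|]. intros z Hzd. specialize (Hz z Hzd).
  rewrite sum_O, <- A0, pow_1 in Hz.
  replace (phi z - 0 * z ^ 0)%C with (phi z) in Hz by ring. exact Hz.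
Qed.

(** Here [H_j = (phi / z)^(2j+1)].  From [|phi| < 1] one gets [|H_j| <= |z|^-(2j+1)], a bound
    which tends to one at the unit circle. *)
Lemma subordinate_majorant_le (f g : C -> C) (a b : nat -> C) (r : R) :
  odd_analytic f a -> odd_analytic g b -> 0 <= r <= r0_tilde -> subordinate g f ->
  majorant_series (C_derive g) r <= majorant_series (C_derive f) r.
Proof.
  intros Hf Hg Hr [phi [Hphi [Hphi0 [Hphi1 Hgf]]]].
  destruct (analytic_vanishing_at_0 phi Hphi Hphi0) as [M [d [HM [Hd HMd]]]].
  assert (Hpow : forall (z : C) n, z <> 0 -> ((z ^ n) * (phi z * / z) ^ n = phi z ^ n)%C).
  { intros z n Hz. rewrite <- Cpow_mult_l. f_equal. field. exact Hz. }
  apply (majorant_comparison f g a b (fun j z => (phi z * / z) ^ (2 * j + 1))%C); try assumption.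
  - intros j z [Hz0 Hz1]. apply holo_at_pow.
    apply (holo_at_mult phi (fun w => / w)%C).
    + apply analytic_holo; assumption.
    + apply holo_at_inv; [apply holo_at_id | apply Cmod_gt_0, Hz0].
  - intros j. exists (M ^ (2 * j + 1)), d. split; [exact Hd|]. intros z [Hz0 Hz].
    rewrite Cmod_pow. simpl (_ ^ 0). rewrite Rmult_1_r. apply pow_incr.
    split; [apply Cmod_ge_0|].
    rewrite Cmod_mult, Cmod_inv by (apply Cmod_gt_0, Hz0).
    apply Rmult_le_reg_r with (Cmod z); [exact Hz0|].
    rewrite Rmult_assoc, Rinv_l by lra. rewrite Rmult_1_r. apply HMd, Hz.
  - intros j z [Hz0 Hz]. rewrite Cmod_pow. apply pow_incr.
    split; [apply Cmod_ge_0|].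
    rewrite Cmod_mult, Cmod_inv by (apply Cmod_gt_0, Hz0).
    rewrite <- (Rmult_1_l (/ Cmod z)) at 2. apply Rmult_le_compat_r.
    + apply Rlt_le, Rinv_0_lt_compat, Hz0.
    + apply Rlt_le, Hphi1, Hz.
  - intros J. destruct (odd_analytic_remainder f a J Hf) as [Mf [df [HMf [Hdf Hrem]]]].
    assert (Hdm : 0 < df / (M + 1)) by (apply Rdiv_lt_0_compat; lra).
    exists (Mf * M ^ (2 * J + 2)), (Rmin 1 (Rmin d (df / (M + 1)))).
    split; [repeat apply Rmin_pos; lra|]. intros z [Hz0 Hz].
    assert (Hz1 := Rlt_le_trans _ _ _ Hz (Rmin_l _ _)).
    assert (Hz' := Rlt_le_trans _ _ _ Hz (Rmin_r _ _)).
    assert (Hz2 := Rlt_le_trans _ _ _ Hz' (Rmin_l _ _)).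
    assert (Hz3 := Rlt_le_trans _ _ _ Hz' (Rmin_r _ _)).
    assert (Hnz : z <> 0) by (apply Cmod_gt_0, Hz0).
    specialize (HMd z Hz2).
    assert (Hsmall : Cmod (phi z) < df).
    { eapply Rle_lt_trans; [exact HMd|].
      apply Rmult_lt_compat_l with (r := M + 1) in Hz3; [|lra].
      replace ((M + 1) * (df / (M + 1))) with df in Hz3 by (field; lra). nra. }
    specialize (Hrem (phi z) Hsmall).
    rewrite (Hgf z Hz1).
    rewrite (sum_n_ext _ (fun j => a (2 * j + 1)%nat * phi z ^ (2 * j + 1))%C).
    + eapply Rle_trans; [exact Hrem|]. rewrite Rmult_assoc, <- Rpow_mult_distr.
      apply Rmult_le_compat_l; [exact HMf|]. apply pow_incr.
      split; [apply Cmod_ge_0 | exact HMd].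
    + intros j. rewrite <- Cmult_assoc, Hpow by exact Hnz. reflexivity.
Qed.

Definition vanishes_near (F : C -> C) (z0 : C) : Prop :=
  exists d : R, 0 < d /\ forall z : C, Cmod (z - z0)%C < d -> F z = 0.

Lemma analytic_vanishes_near (F : C -> C) (z0 : C) :
  analytic_in_disk F -> in_disk z0 ->
  (forall d, 0 < d -> exists z, 0 < Cmod (z - z0)%C < d /\ F z = 0) -> vanishes_near F z0.
Proof.
  intros H Hz Hacc. destruct (analytic_has_expansion F z0 H Hz) as [rho [A [Hrho HA]]].
  assert (A0 := has_expansion_isolated_zeros F z0 rho A Hrho HA Hacc).
  exists rho. split; [exact Hrho|]. intros z Hzr.
  exact (is_Cpseries_zero _ _ _ A0 (HA z Hzr)).
Qed.

(** The identity theorem along the segment from [z0] to the origin: the largest initial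
    stretch near which [F] vanishes is both closed, since zeros of an analytic function do
    not accumulate, and open. *)
Lemma identity_at_origin (F : C -> C) (z0 : C) :
  analytic_in_disk F -> in_disk z0 -> vanishes_near F z0 -> vanishes_near F 0.
Proof.
  intros HF Hz0 Hv.
  destruct (Ceq_dec z0 0) as [E|Hn]; [rewrite <- E; exact Hv|].
  assert (Hm : 0 < Cmod z0) by (apply Cmod_gt_0; exact Hn).
  unfold in_disk in Hz0.
  set (pt := fun s : R => (RtoC (1 - s) * z0)%C).
  assert (Hdist : forall s t, Cmod (pt s - pt t)%C = Rabs (t - s) * Cmod z0).
  { intros s t. unfold pt.
    replace (RtoC (1 - s) * z0 - RtoC (1 - t) * z0)%C with (RtoC (t - s) * z0)%C
      by (rewrite !RtoC_minus; ring).
    rewrite Cmod_mult, Cmod_R. reflexivity. }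
  assert (Hdisk : forall s, 0 <= s <= 1 -> in_disk (pt s)).
  { intros s Hs. unfold in_disk, pt. rewrite Cmod_mult, Cmod_R, Rabs_pos_eq by lra. nra. }
  set (S := fun s => 0 <= s <= 1 /\ forall t, 0 <= t <= s -> vanishes_near F (pt t)).
  assert (S0 : S 0).
  { split; [lra|]. intros t Ht. replace t with 0 by lra. unfold pt.
    replace (RtoC (1 - 0) * z0)%C with z0; [exact Hv|]. rewrite RtoC_minus. ring. }
  destruct (completeness S) as [s [Hub Hlub]].
  { exists 1. intros x [Hx _]. lra. }
  { exists 0. exact S0. }
  assert (Hs : 0 <= s <= 1).
  { split; [apply Hub, S0 | apply Hlub; intros x [Hx _]; lra]. }
  assert (Hbelow : forall t, 0 <= t < s -> vanishes_near F (pt t)).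
  { intros t Ht. apply NNPP. intros Hno.
    assert (s <= t); [|lra]. apply Hlub. intros x [Hx1 Hx2].
    apply Rnot_lt_le. intros Hlt. apply Hno, Hx2. lra. }
  assert (Hvs : vanishes_near F (pt s)).
  { destruct (Req_dec s 0) as [E|E]; [rewrite E; apply (proj2 S0); lra|].
    apply analytic_vanishes_near; [exact HF | apply Hdisk, Hs|].
    intros d Hd. set (t := Rmax (s / 2) (s - d / (2 * Cmod z0))).
    assert (Hq : 0 < d / (2 * Cmod z0)) by (apply Rdiv_lt_0_compat; lra).
    assert (Ht1 : s / 2 <= t) by apply Rmax_l.
    assert (Ht2 : s - d / (2 * Cmod z0) <= t) by apply Rmax_r.
    assert (Ht3 : t < s) by (unfold t; apply Rmax_lub_lt; lra).
    exists (pt t). rewrite Hdist, Rabs_pos_eq by lra. split; [split|].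
    - apply Rmult_lt_0_compat; lra.
    - apply Rle_lt_trans with (d / (2 * Cmod z0) * Cmod z0).
      + apply Rmult_le_compat_r; lra.
      + replace (d / (2 * Cmod z0) * Cmod z0) with (d / 2) by (field; lra). lra.
    - destruct (Hbelow t ltac:(lra)) as [e [He Hz]]. apply Hz, center_in_ball, He. }
  destruct (Req_dec s 1) as [E|E].
  { rewrite E in Hvs. unfold pt in Hvs.
    replace (RtoC (1 - 1) * z0)%C with (RtoC 0) in Hvs; [exact Hvs|]. rewrite RtoC_minus. ring. }
  exfalso.
  destruct Hvs as [d [Hd Hvs]].
  set (s' := Rmin 1 (s + d / (2 * Cmod z0))).
  assert (Hq : 0 < d / (2 * Cmod z0)) by (apply Rdiv_lt_0_compat; lra).
  assert (Hs1 : s' <= 1) by apply Rmin_l.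
  assert (Hs2 : s' <= s + d / (2 * Cmod z0)) by apply Rmin_r.
  assert (Hs3 : s < s') by (unfold s'; apply Rmin_glb_lt; lra).
  assert (S s'); [|specialize (Hub s' H); lra].
  split; [lra|]. intros t Ht.
  destruct (Rlt_le_dec t s) as [Hlt|Hle]; [apply Hbelow; lra|].
  exists (d / 2). split; [lra|]. intros z Hz. apply Hvs.
  replace (z - pt s)%C with ((z - pt t) + (pt t - pt s))%C by ring.
  eapply Rle_lt_trans; [apply Cmod_triangle|].
  rewrite Hdist, Rabs_left1 by lra.
  assert (- (s - t) * Cmod z0 <= d / (2 * Cmod z0) * Cmod z0) by (apply Rmult_le_compat_r; lra).
  replace (d / (2 * Cmod z0) * Cmod z0) with (d / 2) in H by (field; lra). lra.
Qed.

(** As [F] is bounded near [z0], the factor [|z - z0|] makes [G] tend to zero. *)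
Lemma vanishing_of_small_ratio (F G : C -> C) (z0 : C) (d : R) :
  0 < d -> Ccontinuous F z0 -> Ccontinuous G z0 ->
  (forall z, 0 < Cmod (z - z0)%C < d -> Cmod (G z) <= Cmod (z - z0)%C * Cmod (F z)) ->
  G z0 = 0.
Proof.
  intros Hd HF HG H. apply NNPP. intros Hn.
  assert (Hm : 0 < Cmod (G z0)) by (apply Cmod_gt_0; exact Hn).
  set (m := Cmod (G z0)) in *. set (N := Cmod (F z0) + 1).
  assert (HN : 1 <= N) by (unfold N; generalize (Cmod_ge_0 (F z0)); lra).
  destruct (proj1 (Ccontinuous_eps _ _) HF 1 Rlt_0_1) as [d1 [Hd1 H1]].
  destruct (proj1 (Ccontinuous_eps _ _) HG (m / 2) ltac:(lra)) as [d2 [Hd2 H2]].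
  assert (Hq : 0 < m / (2 * N)) by (apply Rdiv_lt_0_compat; lra).
  destruct (Cmod_lt_exists z0 (Rmin (Rmin d (m / (2 * N))) (Rmin d1 d2))) as [z [Hz0 Hz]].
  { repeat apply Rmin_pos; assumption. }
  assert (Hza := Rlt_le_trans _ _ _ Hz (Rmin_l _ _)).
  assert (Hzb := Rlt_le_trans _ _ _ Hz (Rmin_r _ _)).
  specialize (H z (conj Hz0 (Rlt_le_trans _ _ _ Hza (Rmin_l _ _)))).
  assert (Hzm := Rlt_le_trans _ _ _ Hza (Rmin_r _ _)).
  specialize (H1 z (Rlt_le_trans _ _ _ Hzb (Rmin_l _ _))).
  specialize (H2 z (Rlt_le_trans _ _ _ Hzb (Rmin_r _ _))).
  assert (HFz : Cmod (F z) <= N).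
  { replace (F z) with ((F z - F z0) + F z0)%C by ring.
    eapply Rle_trans; [apply Cmod_triangle|]. unfold N. lra. }
  assert (HGz : m / 2 < Cmod (G z)).
  { assert (m <= Cmod (G z) + Cmod (G z - G z0)%C); [|lra].
    unfold m. replace (G z0) with (G z + - (G z - G z0))%C at 1 by ring.
    eapply Rle_trans; [apply Cmod_triangle|]. rewrite Cmod_opp. lra. }
  assert (Cmod (z - z0)%C * Cmod (F z) <= m / (2 * N) * N)
    by (apply Rmult_le_compat; try apply Cmod_ge_0; lra).
  replace (m / (2 * N) * N) with (m / 2) in H0 by (field; lra). lra.
Qed.

(** A zero of [f] is a removable singularity of [g / f]: domination forces [g] to vanish at
    least to the order of [f], so that a common power of [z - z0] cancels. *)
Lemma local_quotient (f g : C -> C) (z0 : C) :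
  analytic_in_disk f -> analytic_in_disk g -> dominated_in_disk g f -> in_disk z0 ->
  ~ vanishes_near f z0 ->
  exists (k : C -> C) (d : R), 0 < d /\ holo_at k z0 /\
    forall z, Cmod (z - z0)%C < d -> g z = (k z * f z)%C /\ (z <> z0 -> f z <> 0).
Proof.
  intros Hf Hg Hdom Hz0 Hnv.
  destruct (analytic_has_expansion f z0 Hf Hz0) as [rf [A [Hrf HA]]].
  destruct (analytic_has_expansion g z0 Hg Hz0) as [rg [B [Hrg HB]]].
  assert (HAn : exists n, A n <> 0).
  { apply NNPP. intros Hno. apply Hnv.
    exists rf. split; [exact Hrf|]. intros z Hz.
    apply (is_Cpseries_zero A (z - z0)%C); [|exact (HA z Hz)].
    intros n. apply NNPP. intros Hn. apply Hno. exists n. exact Hn. }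
  destruct (has_expansion_order f z0 rf A Hrf HA HAn) as [p [F1 [d [[Hd Hdr] [[A1 HA1] [_ HF1]]]]]].
  set (e := Rmin (Rmin d rg) (1 - Cmod z0)).
  unfold in_disk in Hz0.
  assert (He : 0 < e) by (unfold e; repeat apply Rmin_pos; lra).
  assert (Hed : e <= d) by (eapply Rle_trans; apply Rmin_l).
  assert (Heg : e <= rg) by (eapply Rle_trans; [apply Rmin_l | apply Rmin_r]).
  assert (He1 : e <= 1 - Cmod z0) by apply Rmin_r.
  assert (Hdisk : forall z, Cmod (z - z0)%C < e -> in_disk z).
  { intros z Hz. apply (in_disk_near z0). lra. }
  assert (hF1 : holo_at F1 z0) by (eapply has_expansion_holo; [exact HA1 | apply center_in_ball, Hrf]).
  assert (HB0 : forall k, (k < p)%nat -> B k = 0).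
  { intros k. induction k as [k IH] using lt_wf_ind. intros Hk.
    destruct (has_expansion_factor g z0 rg B k Hrg HB (fun i Hi => IH i Hi (Nat.lt_trans _ _ _ Hi Hk)))
      as [G [HG EG]].
    replace (B k) with (G z0).
    2:{ rewrite (has_expansion_center _ _ _ _ Hrg HG). f_equal. lia. }
    apply (vanishing_of_small_ratio (fun z => (z - z0) ^ (p - k - 1) * F1 z)%C G z0 e He).
    - apply holo_at_continuous, holo_at_mult; [|exact hF1].
      apply (holo_at_pow (fun z => z - z0)%C), holo_at_minus; [apply holo_at_id | apply holo_at_const].
    - apply holo_at_continuous. eapply has_expansion_holo; [exact HG | apply center_in_ball, Hrg].
    - intros z [Hz1 Hz2].
      assert (Hle := Hdom z (Hdisk z Hz2)).
      rewrite (EG z (Rlt_le_trans _ _ _ Hz2 Heg)) in Hle.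
      rewrite (proj2 (HF1 z (Rlt_le_trans _ _ _ Hz2 Hed))) in Hle.
      replace p with (k + S (p - k - 1))%nat in Hle at 1 by lia.
      rewrite Cpow_add_r, Cpow_S in Hle.
      rewrite !Cmod_mult in Hle. rewrite !Cmod_mult, <- Rmult_assoc.
      rewrite (Rmult_assoc (Cmod ((z - z0) ^ k)%C)) in Hle.
      apply Rmult_le_reg_l in Hle; [exact Hle|].
      apply Cmod_gt_0, Cpow_nz, Cmod_gt_0, Hz1. }
  destruct (has_expansion_factor g z0 rg B p Hrg HB HB0) as [G [HG EG]].
  exists (fun z => G z * / F1 z)%C, e. split; [exact He|]. split.
  - apply holo_at_mult.
    + eapply has_expansion_holo; [exact HG | apply center_in_ball, Hrg].
    + apply holo_at_inv; [exact hF1|]. apply HF1, center_in_ball, Hd.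
  - intros z Hz. destruct (HF1 z (Rlt_le_trans _ _ _ Hz Hed)) as [HFz Efz]. split.
    + rewrite (EG z (Rlt_le_trans _ _ _ Hz Heg)), Efz. field. exact HFz.
    + intros Hne. rewrite Efz. apply Cmult_neq_0; [|exact HFz].
      apply Cpow_nz. intros E. apply Hne, Ceq_minus, E.
Qed.

(** Where [f] is not identically zero its zeros are isolated, and the local quotients agree
    outside of them; hence their values at their own centres form one holomorphic function. *)
Lemma bounded_quotient (f g : C -> C) (a : nat -> C) :
  odd_analytic f a -> analytic_in_disk g -> dominated_in_disk g f ->
  exists h : C -> C, forall z, in_disk z -> holo_at h z /\ Cmod (h z) <= 1 /\ g z = (h z * f z)%C.
Proof.
  intros Hfa Hg Hdom. assert (Hf := proj1 Hfa).
  destruct (classic (exists z0, in_disk z0 /\ vanishes_near f z0)) as [[z0 [Hz0 Hv]]|Hno].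
  - (* [f] vanishes identically, hence so does [g] *)
    apply (identity_at_origin f z0 Hf Hz0) in Hv.
    assert (Hexp := proj1 (expansion_in_disk_has_expansion _ _) (odd_analytic_expansion f a Hfa)).
    assert (H0 : forall n, odd_part a n = 0).
    { apply (has_expansion_isolated_zeros f 0 1 _ Rlt_0_1 Hexp).
      intros d Hd. destruct Hv as [e [He Hve]].
      destruct (Cmod_lt_exists 0 (Rmin d e) (Rmin_pos _ _ Hd He)) as [z [Hz1 Hz2]].
      exists z. split; [split; [exact Hz1 | exact (Rlt_le_trans _ _ _ Hz2 (Rmin_l _ _))]|].
      apply Hve. exact (Rlt_le_trans _ _ _ Hz2 (Rmin_r _ _)). }
    assert (Hf0 : forall z, in_disk z -> f z = 0).
    { intros z Hz. exact (is_Cpseries_zero _ _ _ H0 (odd_analytic_expansion f a Hfa z Hz)). }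
    exists (fun _ => RtoC 0). intros z Hz. split; [apply holo_at_const|].
    split; [rewrite Cmod_0; lra|].
    assert (Hle := Hdom z Hz). rewrite (Hf0 z Hz), Cmod_0 in Hle. rewrite Cmult_0_l.
    apply Cmod_eq_0, Rle_antisym; [exact Hle | apply Cmod_ge_0].
  - assert (Hloc : forall z0, exists k : C -> C, in_disk z0 -> exists d, 0 < d /\ holo_at k z0 /\
       forall z, Cmod (z - z0)%C < d -> g z = (k z * f z)%C /\ (z <> z0 -> f z <> 0)).
    { intros z0. destruct (classic (in_disk z0)) as [Hz0|Hz0].
      - destruct (local_quotient f g z0 Hf Hg Hdom Hz0) as [k [d Hk]].
        + intros Hv. apply Hno. exists z0. split; assumption.
        + exists k. intros _. exists d. exact Hk.
      - exists (fun _ => RtoC 0). intros Hc. contradiction. }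
    apply choice in Hloc. destruct Hloc as [k Hk].
    assert (Hgk : forall z, in_disk z -> g z = (k z z * f z)%C).
    { intros z Hz. destruct (Hk z Hz) as [d [Hd [_ H]]]. apply H, center_in_ball, Hd. }
    assert (Hagree : forall z0, in_disk z0 -> locally (T := Cmod_top) z0 (fun z => k z0 z = k z z)).
    { intros z0 Hz0. destruct (Hk z0 Hz0) as [d [Hd [_ H]]]. apply locally_Cmod.
      unfold in_disk in Hz0.
      exists (Rmin d (1 - Cmod z0)). split; [apply Rmin_pos; lra|]. intros z Hz.
      destruct (Ceq_dec z z0) as [E|E]; [rewrite E; reflexivity|].
      destruct (H z (Rlt_le_trans _ _ _ Hz (Rmin_l _ _))) as [H1 H2]. specialize (H2 E).
      assert (Hzd : in_disk z).
      { apply (in_disk_near z0). exact (Rlt_le_trans _ _ _ Hz (Rmin_r _ _)). }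
      rewrite (Hgk z Hzd) in H1.
      replace (k z z) with (k z z * f z / f z)%C by (field; exact H2).
      rewrite H1. field. exact H2. }
    assert (Hholo : forall z, in_disk z -> holo_at (fun w => k w w) z).
    { intros z Hz. apply (holo_at_ext_loc (k z)); [apply Hagree, Hz|].
      destruct (Hk z Hz) as [d [_ [H _]]]. exact H. }
    exists (fun z => k z z). intros z0 Hz0. split; [apply Hholo, Hz0|]. split; [|apply Hgk, Hz0].
    apply Rnot_lt_le. intros Hgt.
    (* by continuity the bound fails near [z0] as well, where [f] has no zero *)
    destruct (proj1 (Ccontinuous_eps _ _) (holo_at_continuous _ _ (Hholo z0 Hz0)) (Cmod (k z0 z0) - 1)
               ltac:(lra)) as [d1 [Hd1 H1]].
    destruct (Hk z0 Hz0) as [d [Hd [_ H]]]. 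
    assert (Hz0' := Hz0). unfold in_disk in Hz0'.
    destruct (Cmod_lt_exists z0 (Rmin (Rmin d d1) (1 - Cmod z0))) as [z [Hz1 Hz2]].
    { repeat apply Rmin_pos; lra. }
    assert (Hza := Rlt_le_trans _ _ _ Hz2 (Rmin_l _ _)).
    assert (Hzb := Rlt_le_trans _ _ _ Hz2 (Rmin_r _ _)).
    assert (Hfz : f z <> 0).
    { apply (H z (Rlt_le_trans _ _ _ Hza (Rmin_l _ _))). intros E. rewrite E in Hz1.
      replace (z0 - z0)%C with (RtoC 0) in Hz1 by ring. rewrite Cmod_0 in Hz1. lra. }
    specialize (H1 z (Rlt_le_trans _ _ _ Hza (Rmin_r _ _))).
    assert (Hzd : in_disk z).
    { apply (in_disk_near z0). exact Hzb. }
    assert (Hle := Hdom z Hzd). rewrite (Hgk z Hzd), Cmod_mult in Hle.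
    assert (Hfp : 0 < Cmod (f z)) by (apply Cmod_gt_0; exact Hfz).
    assert (Hk1 : Cmod (k z z) <= 1).
    { apply Rmult_le_reg_r with (Cmod (f z)); [exact Hfp | lra]. }
    assert (Cmod (k z0 z0) <= Cmod (k z z) + Cmod (k z z - k z0 z0)%C); [|lra].
    replace (k z0 z0) with (k z z + - (k z z - k z0 z0))%C at 1 by ring.
    eapply Rle_trans; [apply Cmod_triangle|]. rewrite Cmod_opp. lra.
Qed.

Lemma dominated_majorant_le (f g : C -> C) (a b : nat -> C) (r : R) :
  odd_analytic f a -> odd_analytic g b -> 0 <= r <= r0_tilde -> dominated_in_disk g f ->
  majorant_series (C_derive g) r <= majorant_series (C_derive f) r.
Proof.
  intros Hf Hg Hr Hdom.
  destruct (bounded_quotient f g a Hf (proj1 Hg) Hdom) as [h Hh].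
  apply (majorant_comparison f g a b (fun _ => h)); try assumption.
  - intros _ z [_ Hz]. apply Hh, Hz.
  - intros _. exists 1, 1. split; [lra|]. intros z [_ Hz]. simpl. rewrite Rmult_1_r. apply Hh, Hz.
  - intros j z [Hz0 Hz]. apply Rle_trans with 1; [apply Hh, Hz|].
    rewrite <- (pow1 (2 * j + 1)) at 1. apply pow_incr. split; [lra|].
    rewrite <- Rinv_1. apply Rinv_le_contravar; lra.
  - intros J. destruct (odd_analytic_remainder f a J Hf) as [M [d [HM [Hd Hrem]]]].
    exists M, (Rmin d 1). split; [apply Rmin_pos; lra|]. intros z [Hz0 Hz].
    specialize (Hrem z (Rlt_le_trans _ _ _ Hz (Rmin_l _ _))).
    destruct (Hh z (Rlt_le_trans _ _ _ Hz (Rmin_r _ _))) as [_ [Hh1 Hgz]].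
    rewrite Hgz.
    rewrite (sum_n_ext _ (fun j => h z * (a (2 * j + 1)%nat * z ^ (2 * j + 1)))%C).
    + rewrite <- Csum_mult.
      match goal with |- Cmod (h z * ?X - h z * ?Y)%C <= _ =>
        replace (h z * X - h z * Y)%C with (h z * (X - Y))%C by ring end.
      rewrite Cmod_mult. rewrite <- (Rmult_1_l (M * _)).
      apply Rmult_le_compat; try apply Cmod_ge_0; assumption.
    + intros j. ceq. ring.
Qed.

(** * Sharpness of the radius *)

Lemma is_Cseries_ext (u v : nat -> C) (l : C) :
  (forall n, u n = v n) -> is_Cseries u l -> is_Cseries v l.
Proof. apply is_series_ext. Qed.

Lemma is_Cseries_geom (q : C) : Cmod q < 1 -> is_Cseries (fun n => q ^ n)%C (/ (1 - q))%C.
Proof.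
  intros Hq. assert (Hc := Cmod_ge_0 q).
  destruct (ex_Cseries_Cmod (fun n => q ^ n)%C) as [l Hl].
  { apply (ex_series_ext (fun n => Cmod q ^ n)).
    - intros n. symmetry. apply Cmod_pow.
    - apply ex_series_geom. rewrite Rabs_pos_eq by exact Hc. exact Hq. }
  assert (H1 : (1 - q)%C <> 0).
  { intros E. apply Ceq_minus in E. rewrite <- E, Cmod_1 in Hq. lra. }
  assert (E : (l - 1 = q * l)%C).
  { apply (is_Cseries_unique (fun n => q ^ S n)%C).
    - exact (proj1 (is_Cseries_shift _ _) Hl).
    - exact (is_series_scal (K := C_AbsRing) (V := C_NormedModule) q _ _ Hl). }
  replace (/ (1 - q))%C with l; [exact Hl|].
  replace (/ (1 - q))%C with ((l - (l - 1)) / (1 - q))%C by (field; exact H1).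
  rewrite E. ceq. field. exact H1.
Qed.

Lemma analytic_ext (F G : C -> C) :
  (forall z, in_disk z -> F z = G z) -> analytic_in_disk F -> analytic_in_disk G.
Proof.
  intros E H z0 Hz0. destruct (H z0 Hz0) as [rho [A [Hr HA]]].
  assert (Hz0' := Hz0). unfold in_disk in Hz0'.
  exists (Rmin rho (1 - Cmod z0)), A. split; [apply Rmin_pos; lra|]. intros z Hz.
  rewrite <- E.
  - apply HA. exact (Rlt_le_trans _ _ _ Hz (Rmin_l _ _)).
  - apply (in_disk_near z0). exact (Rlt_le_trans _ _ _ Hz (Rmin_r _ _)).
Qed.

Lemma analytic_lin_comb (c d : C) (F G : C -> C) :
  analytic_in_disk F -> analytic_in_disk G -> analytic_in_disk (fun z => c * F z + d * G z)%C.
Proof.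
  intros HF HG z0 Hz0. destruct (HF z0 Hz0) as [r1 [A [Hr1 HA]]].
  destruct (HG z0 Hz0) as [r2 [B [Hr2 HB]]].
  exists (Rmin r1 r2), (PS_plus (PS_scal (V := C_NormedModule) (c : C_AbsRing) A)
                          (PS_scal (V := C_NormedModule) (d : C_AbsRing) B)).
  split; [apply Rmin_pos; assumption|]. intros z Hz.
  apply (is_pseries_plus (K := C_AbsRing) (V := C_NormedModule));
    apply (is_pseries_scal (K := C_AbsRing) (V := C_NormedModule)); try apply Cmult_comm.
  - apply HA. exact (Rlt_le_trans _ _ _ Hz (Rmin_l _ _)).
  - apply HB. exact (Rlt_le_trans _ _ _ Hz (Rmin_r _ _)).
Qed.

Lemma analytic_id : analytic_in_disk (fun z => z).
Proof.
  intros z0 _. exists 1, (fun n => match n with 0%nat => z0 | 1%nat => RtoC 1 | _ => RtoC 0 end).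
  split; [lra|]. intros z _. apply is_Cpseries_series, is_Cseries_shift, is_Cseries_shift.
  replace (z - z0 * (z - z0) ^ 0 - 1 * (z - z0) ^ 1)%C with (RtoC 0) by (simpl; ring).
  apply (is_Cseries_ext (fun _ => RtoC 0)); [|apply is_Cseries_zero].
  intros n. ring.
Qed.

Lemma analytic_simple_fraction (s : C) :
  Cmod s <= 1 -> analytic_in_disk (fun z => / (1 - s * z))%C.
Proof.
  intros Hs z0 Hz0. unfold in_disk in Hz0.
  set (D := (1 - s * z0)%C).
  assert (HD : D <> 0).
  { intros E. apply Ceq_minus in E. apply (f_equal Cmod) in E.
    rewrite Cmod_1, Cmod_mult in E. generalize (Cmod_ge_0 z0) (Cmod_ge_0 s). nra. }
  assert (HDp : 0 < Cmod D) by (apply Cmod_gt_0; exact HD).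
  exists (Cmod D), (fun n => s ^ n * (/ D) ^ S n)%C. split; [exact HDp|]. intros z Hz.
  apply is_Cpseries_series.
  set (q := (s * / D * (z - z0))%C).
  assert (Hq : Cmod q < 1).
  { unfold q. rewrite !Cmod_mult, Cmod_inv by exact HD.
    apply Rle_lt_trans with (1 * / Cmod D * Cmod (z - z0)%C).
    - apply Rmult_le_compat_r; [apply Cmod_ge_0|].
      apply Rmult_le_compat_r; [apply Rlt_le, Rinv_0_lt_compat, HDp | exact Hs].
    - apply Rmult_lt_reg_l with (Cmod D); [exact HDp|].
      replace (Cmod D * (1 * / Cmod D * Cmod (z - z0)%C)) with (Cmod (z - z0)%C) by (field; lra).
      lra. }
  assert (H1 : (1 - q)%C <> 0).
  { intros E. apply Ceq_minus in E. rewrite <- E, Cmod_1 in Hq. lra. }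
  assert (E1 : ((1 - s * z) = D * (1 - q))%C) by (unfold q, D; field; exact HD).
  rewrite E1.
  replace (/ (D * (1 - q)))%C with (/ D * / (1 - q))%C by (field; split; assumption).
  apply (is_Cseries_ext (fun n => / D * q ^ n)%C).
  - intros n. unfold q. rewrite !Cpow_mult_l, Cpow_S. ring.
  - exact (is_series_scal (K := C_AbsRing) (V := C_NormedModule) (/ D)%C _ _ (is_Cseries_geom q Hq)).
Qed.

(** For [n = 2j+1] the number [Nat.div2 n] is [j], the index in the odd series. *)
Definition id_coeffs (n : nat) : C := match Nat.div2 n with 0%nat => 1 | _ => 0 end.

Definition blaschke_coeffs (t : R) (n : nat) : C :=
  RtoC (match Nat.div2 n with 0%nat => t | S m => - ((1 - t ^ 2) * t ^ m) end).

(** The extremal function: [z] times the disc automorphism [(t - w) / (1 - t w)] evaluated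
    at [w = z^2]. *)
Definition odd_blaschke (t : R) (z : C) : C :=
  (z * ((RtoC t - z ^ 2) / (1 - RtoC t * z ^ 2)))%C.

Lemma div2_odd_index (j : nat) : Nat.div2 (2 * j + 1) = j.
Proof. rewrite Nat.add_1_r. apply Nat.div2_succ_double. Qed.

Lemma odd_analytic_id : odd_analytic (fun z => z) id_coeffs.
Proof.
  split; [apply analytic_id|]. intros z _. apply is_Cseries_shift.
  match goal with |- is_series _ ?x => replace x with (RtoC 0) end.
  - apply (is_Cseries_ext (fun _ => RtoC 0)); [|apply is_Cseries_zero].
    intros n. unfold id_coeffs. rewrite div2_odd_index. ring.
  - unfold id_coeffs. simpl. ring.
Qed.

Lemma blaschke_denominator (t : R) (z : C) :
  0 < t < 1 -> in_disk z -> Cmod (RtoC t * z ^ 2)%C < 1 /\ (1 - RtoC t * z ^ 2)%C <> 0.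
Proof.
  intros Ht Hz. unfold in_disk in Hz. 
  assert (H : Cmod (RtoC t * z ^ 2)%C < 1).
  { rewrite Cmod_mult, Cmod_pow, Cmod_R, Rabs_pos_eq by lra.
    generalize (Cmod_ge_0 z). simpl. nra. }
  split; [exact H|]. intros E. apply Ceq_minus in E. rewrite <- E, Cmod_1 in H. lra.
Qed.

Lemma odd_blaschke_le (t : R) (z : C) :
  0 < t < 1 -> in_disk z -> Cmod (odd_blaschke t z) <= Cmod z.
Proof.
  intros Ht Hz. destruct (blaschke_denominator t z Ht Hz) as [_ Hd].
  unfold odd_blaschke. rewrite Cmod_mult, Cmod_div by exact Hd.
  rewrite <- (Rmult_1_r (Cmod z)) at 2. apply Rmult_le_compat_l; [apply Cmod_ge_0|].
  assert (Hp : 0 < Cmod (1 - RtoC t * z ^ 2)%C) by (apply Cmod_gt_0; exact Hd).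
  apply Rmult_le_reg_r with (Cmod (1 - RtoC t * z ^ 2)%C); [exact Hp|].
  unfold Rdiv. rewrite Rmult_assoc, Rinv_l by lra. rewrite Rmult_1_l, Rmult_1_r.
  assert (Hw : Cmod (z ^ 2)%C ^ 2 <= 1).
  { rewrite Cmod_pow. unfold in_disk in Hz. assert (H0 := Cmod_ge_0 z).
    assert (H1 : Cmod z ^ 2 <= 1) by (simpl; nra). assert (H2 : 0 <= Cmod z ^ 2) by (simpl; nra).
    set (y := Cmod z ^ 2) in *. simpl. nra. }
  destruct (z ^ 2)%C as [p q]. rewrite Cmod2_alt in Hw. simpl in Hw.
  assert (Hprod : 0 <= (1 - t * t) * (1 - (p * p + q * q))) by (apply Rmult_le_pos; nra).
  unfold Cmod. apply sqrt_le_1_alt. simpl. lra.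
Qed.

Lemma odd_analytic_blaschke (t : R) :
  0 < t < 1 -> odd_analytic (odd_blaschke t) (blaschke_coeffs t).
Proof.
  intros Ht. assert (Ht0 : RtoC t <> 0) by (intros E; apply RtoC_inj in E; lra).
  split.
  - (* partial fractions, with poles at [1 / s] and [- 1 / s] where [s ^ 2 = t] *)
    set (s := sqrt t).
    assert (Hs : s * s = t) by (apply sqrt_sqrt; lra).
    assert (Hs0 : 0 < s) by (apply sqrt_lt_R0; lra).
    assert (Hs1 : s <= 1) by nra.
    assert (HsC : RtoC s <> 0) by (intros E; apply RtoC_inj in E; lra).
    assert (H2 : RtoC 2 <> 0) by (intros E; apply RtoC_inj in E; lra).
    assert (HsT : (RtoC t = RtoC s * RtoC s)%C) by (rewrite <- RtoC_mult, Hs; reflexivity).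
    apply (analytic_ext (fun z => (/ RtoC t) * z + (- ((1 - RtoC t ^ 2) / RtoC t)) *
       ((/ (RtoC 2 * RtoC s)) * / (1 - RtoC s * z)
        + (- / (RtoC 2 * RtoC s)) * / (1 - (- RtoC s) * z)))%C).
    + intros z Hz. destruct (blaschke_denominator t z Ht Hz) as [_ Hd].
      rewrite HsT in Hd |- *.
      assert (Hf : (1 - RtoC s * RtoC s * z ^ 2 = (1 - RtoC s * z) * (1 - (- RtoC s) * z))%C)
        by (simpl; ring).
      rewrite Hf in Hd.
      assert (Ha : (1 - RtoC s * z)%C <> 0) by (intros E; apply Hd; rewrite E; ring).
      assert (Hb : (1 - (- RtoC s) * z)%C <> 0) by (intros E; apply Hd; rewrite E; ring).
      assert (Hb' : (1 + RtoC s * z)%C <> 0)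
        by (replace (1 + RtoC s * z)%C with (1 - (- RtoC s) * z)%C by ring; exact Hb).
      unfold odd_blaschke. rewrite HsT, Hf. simpl.
      replace (1 - - RtoC s * z)%C with (1 + RtoC s * z)%C by ring.
      replace (RtoC 2) with (1 + 1)%C in * by (rewrite <- RtoC_plus; f_equal; lra).
      field. repeat split; assumption.
    + apply (analytic_lin_comb _ _ (fun z => z)); [apply analytic_id|].
      apply (analytic_lin_comb _ _ (fun z => / (1 - RtoC s * z))%C (fun z => / (1 - (- RtoC s) * z))%C);
        apply analytic_simple_fraction; rewrite ?Cmod_opp, Cmod_R, Rabs_pos_eq; lra.
  - intros z Hz. destruct (blaschke_denominator t z Ht Hz) as [Hq Hd].
    apply is_Cseries_shift.
    assert (G := is_series_scal (K := C_AbsRing) (V := C_NormedModule)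
       (- RtoC (1 - t ^ 2) * z ^ 3)%C _ _ (is_Cseries_geom _ Hq)).
    match goal with |- is_series _ ?x =>
      replace x with (scal (- RtoC (1 - t ^ 2) * z ^ 3)%C (/ (1 - RtoC t * z ^ 2))%C) end.
    + eapply is_Cseries_ext; [|exact G]. intros n.
      unfold blaschke_coeffs. rewrite div2_odd_index.
      replace (2 * S n + 1)%nat with (2 * n + 3)%nat by lia.
      unfold scal; simpl (ModuleSpace.scal _ _ _ _ _). unfold mult.
      change (- RtoC (1 - t ^ 2) * z ^ 3 * (RtoC t * z ^ 2) ^ n
              = RtoC (- ((1 - t ^ 2) * t ^ n)) * z ^ (2 * n + 3))%C.
      rewrite Cpow_mult_l, <- Cpow_mult_r, RtoC_opp, RtoC_mult, RtoC_pow, Cpow_add_r. ring.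
    + change (- RtoC (1 - t ^ 2) * z ^ 3 * / (1 - RtoC t * z ^ 2)
        = odd_blaschke t z - RtoC t * z ^ 1)%C.
      unfold odd_blaschke. rewrite RtoC_minus, RtoC_pow. simpl. field.
      replace (z * z)%C with (z ^ 2)%C by (simpl; ring). exact Hd.
Qed.

Lemma majorant_id (r : R) : 0 <= r < 1 -> majorant_series (C_derive (fun z => z)) r = 1.
Proof.
  intros Hr. assert (H := odd_analytic_majorant _ _ r odd_analytic_id Hr).
  apply is_series_unique in H. rewrite <- H. apply is_series_unique.
  apply (is_series_decr_1 (K := R_AbsRing) (V := R_NormedModule)).
  match goal with |- is_series _ ?x => replace x with 0 end.
  - intros P HP. exists 0%nat. intros n _.
    rewrite (sum_n_ext _ (fun _ => 0)).
    + rewrite sum_n_const, Rmult_0_r. exact (locally_singleton _ _ HP).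
    + intros k. unfold id_coeffs. rewrite div2_odd_index, Cmod_0. 
      match goal with |- ?x = ?y => change (@eq R x y) end. ring.
  - unfold plus, opp; simpl. unfold id_coeffs. simpl. rewrite Cmod_1. ring.
Qed.

Lemma Rseries_shift (u : nat -> R) (l : R) :
  is_series u l -> is_series (fun k => u (S k)) (l - u 0%nat).
Proof.
  intros H. apply (is_series_incr_1 (K := R_AbsRing) (V := R_NormedModule)).
  match goal with |- is_series _ ?x => replace x with l end; [exact H|].
  unfold plus; simpl. ring.
Qed.

(** With [y = t r^2], the sum of the terms after the first one is computed from the linear
    equation that shifting the index gives: each term is [y] times the previous one, plus a
    term of a geometric series. *)
Lemma majorant_blaschke (t r : R) : 0 < t < 1 -> 0 <= r < 1 ->
  majorant_series (C_derive (odd_blaschke t)) r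
  = t + (1 - t ^ 2) * r ^ 2 * (3 - t * r ^ 2) / (1 - t * r ^ 2) ^ 2.
Proof.
  intros Ht Hr. set (x := r ^ 2). assert (Hx : 0 <= x < 1) by (unfold x; simpl; nra).
  set (y := t * x). assert (Hy : 0 <= y < 1) by (unfold y; nra).
  assert (H := odd_analytic_majorant _ _ r (odd_analytic_blaschke t Ht) Hr).
  fold x in H. set (M := majorant_series (C_derive (odd_blaschke t)) r) in *.
  assert (Ht2 : 0 <= 1 - t ^ 2) by (simpl; nra).
  set (T := fun m => (2 * INR m + 3) * x ^ S m * ((1 - t ^ 2) * t ^ m)).
  assert (HT : is_series T (M - t)).
  { apply (Rseries_shift _ M) in H. 
    replace (M - t) with (M - INR (2 * 0 + 1) * x ^ 0 * Cmod (blaschke_coeffs t (2 * 0 + 1))).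
    - eapply is_series_ext; [|exact H]. intros m. cbv beta.
      unfold blaschke_coeffs. rewrite div2_odd_index, Cmod_R, Rabs_Ropp.
      rewrite Rabs_pos_eq by (apply Rmult_le_pos; [exact Ht2 | apply pow_le; lra]).
      replace (INR (2 * S m + 1)) with (2 * INR m + 3)
        by (rewrite plus_INR, mult_INR, (S_INR m); simpl; ring).
      unfold T.
      match goal with |- ?a = ?b => change (@eq R a b) end. ring.
    - unfold blaschke_coeffs. simpl. rewrite Cmod_R, Rabs_pos_eq by lra. ring. }
  assert (HT1 := Rseries_shift _ _ HT). cbv beta in HT1.
  assert (HT2 : is_series (fun m => T (S m)) (y * (M - t) + 2 * (1 - t ^ 2) * x * y * / (1 - y))).
  { assert (Hg : is_series (fun n => y ^ n) (/ (1 - y)))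
      by (apply is_series_geom; rewrite Rabs_pos_eq; lra).
    assert (Hs := is_series_plus (K := R_AbsRing) (V := R_NormedModule) _ _ _ _
      (is_series_scal_l y _ _ HT) (is_series_scal_l (2 * (1 - t ^ 2) * x * y) _ _ Hg)).
    eapply is_series_ext; [|exact Hs]. intros m. cbv beta.
    unfold plus, T; simpl (AbelianMonoid.plus _ _ _ _).
    change (y * ((2 * INR m + 3) * x ^ S m * ((1 - t ^ 2) * t ^ m)) + 2 * (1 - t ^ 2) * x * y * y ^ m
      = (2 * INR (S m) + 3) * x ^ S (S m) * ((1 - t ^ 2) * t ^ S m)).
    unfold y. rewrite S_INR, Rpow_mult_distr, <- !tech_pow_Rmult. ring. }
  assert (E := is_series_unique _ _ HT1). rewrite (is_series_unique _ _ HT2) in E.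
  unfold T in E. simpl (INR 0) in E. rewrite pow_1, pow_O in E.
  apply Rminus_diag_uniq.
  apply (Rmult_eq_reg_r ((1 - y) ^ 2)); [|apply pow_nonzero; lra].
  unfold y in *.
  replace ((M - (t + (1 - t ^ 2) * x * (3 - t * x) / (1 - t * x) ^ 2)) * (1 - t * x) ^ 2)
    with (((M - t) - t * x * (M - t)) * (1 - t * x) - (1 - t ^ 2) * x * (3 - t * x)) by (field; lra).
  replace (M - t - t * x * (M - t)) with
    ((2 * 0 + 3) * x * ((1 - t ^ 2) * 1) + 2 * (1 - t ^ 2) * x * (t * x) * / (1 - t * x)) by lra.
  field. lra.
Qed.

(** As [t] tends to one, [(majorant - 1) / (1 - t)] tends to
    [- (3 x^2 - 8 x + 1) / (1 - x)^2] with [x = r^2], which is positive beyond the critical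
    radius. *)
Lemma majorant_blaschke_gt (r : R) : r0_tilde < r < 1 ->
  exists t, 0 < t < 1 /\ 1 < majorant_series (C_derive (odd_blaschke t)) r.
Proof.
  intros [Hr0 Hr1].
  assert (Hp : 0 <= r0_tilde) by apply sqrt_pos.
  set (x := r ^ 2). assert (Hx : 0 < x < 1) by (unfold x; simpl; nra).
  assert (Hq : 3 * x ^ 2 - 8 * x + 1 < 0).
  { assert (Hs : sqrt 13 * sqrt 13 = 13) by (apply sqrt_sqrt; lra).
    assert (Hs0 : 0 <= sqrt 13) by apply sqrt_pos.
    assert (Hx0 : 0 <= (4 - sqrt 13) / 3) by nra.
    assert (H : (4 - sqrt 13) / 3 < x).
    { rewrite <- (sqrt_sqrt _ Hx0). change (sqrt ((4 - sqrt 13) / 3)) with r0_tilde.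
      unfold x. simpl. rewrite Rmult_1_r. apply Rmult_le_0_lt_compat; lra. }
    simpl. nra. }
  set (P := fun t => (1 - t * x) ^ 2 - (1 + t) * x * (3 - t * x)).
  assert (HP : exists t, 0 < t < 1 /\ P t < 0).
  { apply NNPP. intros Hno. assert (H1 : 0 <= P 1).
    { apply limit_at_one; [unfold P; reg|]. intros t Ht. apply Rnot_lt_le. intros Hlt.
      apply Hno. exists t. split; assumption. }
    unfold P in H1. simpl in *. lra. }
  destruct HP as [t [Ht HPt]]. exists t. split; [exact Ht|].
  rewrite majorant_blaschke by lra. fold x.
  assert (Hy : 0 < 1 - t * x) by nra.
  assert (Hy2 : 0 < (1 - t * x) ^ 2) by (apply pow_lt; exact Hy).
  unfold P in HPt.
  apply Rmult_lt_reg_r with ((1 - t * x) ^ 2); [exact Hy2|].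
  replace ((t + (1 - t ^ 2) * x * (3 - t * x) / (1 - t * x) ^ 2) * (1 - t * x) ^ 2)
    with (t * (1 - t * x) ^ 2 + (1 - t) * ((1 + t) * x * (3 - t * x))) by (field; lra).
  assert ((1 - t) * (1 - t * x) ^ 2 < (1 - t) * ((1 + t) * x * (3 - t * x)))
    by (apply Rmult_lt_compat_l; lra).
  lra.
Qed.

Theorem theorem4 :
  (forall (f g : C -> C) (a b : nat -> C),
     odd_analytic f a -> odd_analytic g b ->
     forall r : R, 0 <= r <= r0_tilde ->
       (subordinate g f ->
          majorant_series (C_derive g) r <= majorant_series (C_derive f) r) /\
       (dominated_in_disk g f ->
          majorant_series (C_derive g) r <= majorant_series (C_derive f) r)) /\
  (forall r : R, r0_tilde < r < 1 ->
     exists (f g : C -> C) (a b : nat -> C),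
       odd_analytic f a /\ odd_analytic g b /\ subordinate g f /\
       majorant_series (C_derive g) r > majorant_series (C_derive f) r) /\
  (forall r : R, r0_tilde < r < 1 ->
     exists (f g : C -> C) (a b : nat -> C),
       odd_analytic f a /\ odd_analytic g b /\ dominated_in_disk g f /\
       majorant_series (C_derive g) r > majorant_series (C_derive f) r).
Proof.
  assert (Hsharp : forall r, r0_tilde < r < 1 -> exists t, 0 < t < 1 /\
    majorant_series (C_derive (odd_blaschke t)) r > majorant_series (C_derive (fun z => z)) r).
  { intros r Hr. destruct (majorant_blaschke_gt r Hr) as [t [Ht HM]]. exists t.
    split; [exact Ht|]. rewrite majorant_id; [exact HM|].
    assert (Hp : 0 <= r0_tilde) by apply sqrt_pos. lra. }
  split; [|split].
  - intros f g a b Hf Hg r Hr. split; intros H.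
    + apply (subordinate_majorant_le f g a b); assumption.
    + apply (dominated_majorant_le f g a b); assumption.
  - intros r Hr. destruct (Hsharp r Hr) as [t [Ht HM]].
    exists (fun z => z), (odd_blaschke t), id_coeffs, (blaschke_coeffs t).
    assert (Hb := odd_analytic_blaschke t Ht).
    split; [apply odd_analytic_id|]. split; [exact Hb|]. split; [|exact HM].
    exists (odd_blaschke t). split; [apply Hb|]. split; [|split].
    + unfold odd_blaschke. apply Cmult_0_l.
    + intros z Hz. eapply Rle_lt_trans; [apply odd_blaschke_le; assumption | exact Hz].
    + reflexivity.
  - intros r Hr. destruct (Hsharp r Hr) as [t [Ht HM]].
    exists (fun z => z), (odd_blaschke t), id_coeffs, (blaschke_coeffs t).
    split; [apply odd_analytic_id|]. split; [apply odd_analytic_blaschke, Ht|].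
    split; [|exact HM]. intros z Hz. apply odd_blaschke_le; assumption.
Qed.
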